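(* Let $P,Q$ be pure-projective modules over a commutative local noetherian ring $R$. Then $P\cong Q$ as $R$-modules if and only if $P\otimes_R\widehat{R}\cong Q\otimes_R\widehat{R}$ as $\widehat{R}$-modules.
   Context: $\widehat{R}$ is the $\mathfrak{m}$-adic completion of $R$, where $\mathfrak{m}$ is the maximal ideal of $R$. A module is pure-projective if it is isomorphic to a direct summand of a direct sum of finitely presented modules. *)

(* Defs.v *)
From HB Require Import structures.
From mathcomp Require Import all_boot all_algebra.
From mathcomp Require Import boolp classical_sets cardinality.
From mathcomp Require Import freeg.

Set Implicit Arguments.
Unset Strict Implicit.
Unset Printing Implicit Defensive.

Import GRing.Theory.
Local Open Scope ring_scope.
Local Open Scope quotient_scope.

#[local] Obligation Tactic := idtac.

Definition lmod_iso (R : pzRingType) (U V : lmodType R) : Prop :=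
  exists f : {linear U -> V}, bijective f.

Section Span.
Variables (R : comNzRingType) (V : lmodType R).

(* The submodule generated by G, as the intersection of the submodules
   containing G. *)
Definition submod_span (G : set V) : {pred V} :=
  fun x => `[< forall S : submodClosed V,
                 (forall g, G g -> g \in S) -> x \in S >].

Lemma submod_spanP (G : set V) x :
  x \in submod_span G <->
  forall S : submodClosed V, (forall g, G g -> g \in S) -> x \in S.
Proof. by split => [/asboolP | ?]; [|apply/asboolP]. Qed.

Lemma mem_submod_span (G : set V) x : G x -> x \in submod_span G.
Proof. by move=> Gx; apply/submod_spanP => S; apply. Qed.

Lemma submod_span_closed (G : set V) : GRing.submod_closed (submod_span G).
Proof.
split=> [|a x y /submod_spanP xG /submod_spanP yG]; apply/submod_spanP => S GS.
  exact: rpred0.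
by rewrite rpredD ?rpredZ ?xG ?yG.
Qed.

HB.instance Definition _ (G : set V) :=
  GRing.isSubmodClosed.Build R V (submod_span G) (submod_span_closed G).

End Span.

(* Ideals of R, possibly improper, are the submodules of R^o;  [idealr R] is
   the library's type of proper ideals. *)
Definition noetherian (R : comNzRingType) : Prop :=
  forall I : submodClosed R^o, exists (n : nat) (a : 'I_n -> R),
    forall x : R, x \in I <-> exists c : 'I_n -> R, x = \sum_i c i * a i.

Definition maximal_ideal (R : comNzRingType) (m : idealr R) : Prop :=
  forall J : idealr R, {subset m <= J} -> J =i m.

Definition local_with (R : comNzRingType) (m : idealr R) : Prop :=
  maximal_ideal m /\ forall m' : idealr R, maximal_ideal m' -> m' =i m.

Section IdealPowers.
Variable R : comNzRingType.

Definition ideal_mul (I J : {pred R}) : {pred R} :=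
  @submod_span R R^o
    [set x | exists a b : R, [/\ a \in I, b \in J & x = a * b]]%classic.

Definition ideal_pow (I : {pred R}) (n : nat) : {pred R} :=
  iter n (ideal_mul I) predT.

Lemma ideal_powS I n : ideal_pow I n.+1 = ideal_mul I (ideal_pow I n).
Proof. by []. Qed.

Lemma ideal_pow0E I x : x \in ideal_pow I 0.
Proof. by []. Qed.

Lemma ideal_powM I n (a x : R) :
  x \in ideal_pow I n -> a * x \in ideal_pow I n.
Proof.
by case: n => [//|n]; exact: (@rpredZ R R^o (@submod_span R R^o _) a x).
Qed.

Lemma ideal_pow_zmod I n : zmod_closed (ideal_pow I n.+1).
Proof.
by split=> [|x y xI yI];
  [exact: (@rpred0 R^o (@submod_span R R^o _))
  |exact: (@rpredB R^o (@submod_span R R^o _))].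
Qed.

Variable m : idealr R.

Lemma ideal_pow_sub1 n : {subset ideal_pow m n.+1 <= m}.
Proof.
move=> x /submod_spanP xm.
have mP : @GRing.submod_closed R R^o (m : {pred R}).
  split=> [|a u v um vm]; first exact: rpred0.
  by rewrite rpredD // [_ *: _]mulrC mulrC idealMr.
pose mB := GRing.isSubmodClosed.Build R R^o (m : R -> bool) mP.
pose S : submodClosed R^o := HB.pack_for (submodClosed R^o) (m : R -> bool) mB.
apply: (xm S) => _ [a [b [am _ ->]]].
by rewrite mulrC; exact: idealMr.
Qed.

Lemma ideal_powSS n : {subset ideal_pow m n.+1 <= ideal_pow m n}.
Proof.
elim: n => [//|n IHn] x /submod_spanP xm.
apply: (xm (@submod_span R R^o _)) => _ [a [b [am bm ->]]].
by apply: mem_submod_span; exists a, b; split=> //; exact: IHn.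
Qed.

Lemma ideal_pow_proper n : ring_quotient.proper_ideal (ideal_pow m n.+1).
Proof.
split; last by move=> a u; exact: ideal_powM.
by apply/negP => /ideal_pow_sub1; rewrite idealr1.
Qed.

HB.instance Definition _ n :=
  GRing.isZmodClosed.Build R (ideal_pow m n.+1) (ideal_pow_zmod m n).
HB.instance Definition _ n :=
  isProperIdeal.Build R (ideal_pow m n.+1) (ideal_pow_proper n).

End IdealPowers.

(* The m-adic completion, i.e., the inverse limit of the rings R / m^n.  The
   ring R / m^0 = 0 is left out: the index n stands for R / m^(n+1), because
   quotients by improper ideals are not nonzero rings. *)
Section Completion.
Variables (R : comNzRingType) (m : idealr R).

Definition adic_quot (n : nat) : comNzRingType :=
  {ideal_quot (ideal_pow m n.+1 : idealr R)}.

Definition adic_pi n (r : R) : adic_quot n :=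
  \pi_({ideal_quot (ideal_pow m n.+1 : idealr R)}) r.

Definition adic_proj n (x : adic_quot n.+1) : adic_quot n :=
  adic_pi n (repr x).

Lemma adic_pi_is_zmod n : zmod_morphism (adic_pi n).
Proof. by move=> x y; rewrite /adic_pi rmorphB. Qed.
Lemma adic_pi_is_monoid n : monoid_morphism (adic_pi n).
Proof. by split=> [|x y]; rewrite /adic_pi (rmorph1, rmorphM). Qed.
HB.instance Definition _ n :=
  GRing.isZmodMorphism.Build R (adic_quot n) (adic_pi n) (adic_pi_is_zmod n).
HB.instance Definition _ n :=
  GRing.isMonoidMorphism.Build R (adic_quot n) (adic_pi n)
    (adic_pi_is_monoid n).

Lemma adic_pi_eq n (x y : R) :
  adic_pi n x = adic_pi n y <-> x - y \in ideal_pow m n.+1.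
Proof. by rewrite (Quotient.idealrBE (ideal_pow m n.+1 : idealr R));
  split => [/eqP|/eqP]. Qed.

Lemma adic_pi_surj n (x : adic_quot n) : adic_pi n (repr x) = x.
Proof. exact: reprK. Qed.

Lemma adic_projE n (r : R) : adic_proj (adic_pi n.+1 r) = adic_pi n r.
Proof.
by apply/adic_pi_eq/ideal_powSS/adic_pi_eq; rewrite adic_pi_surj.
Qed.

Lemma adic_proj_is_zmod n : zmod_morphism (@adic_proj n).
Proof.
move=> x y; rewrite -[x]adic_pi_surj -[y]adic_pi_surj.
by rewrite -rmorphB !adic_projE rmorphB.
Qed.
Lemma adic_proj_is_monoid n : monoid_morphism (@adic_proj n).
Proof.
split=> [|x y]; first by rewrite -(rmorph1 (adic_pi n.+1)) adic_projE rmorph1.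
rewrite -[x]adic_pi_surj -[y]adic_pi_surj.
by rewrite -rmorphM !adic_projE rmorphM.
Qed.
HB.instance Definition _ n :=
  GRing.isZmodMorphism.Build (adic_quot n.+1) (adic_quot n) (@adic_proj n)
    (@adic_proj_is_zmod n).
HB.instance Definition _ n :=
  GRing.isMonoidMorphism.Build (adic_quot n.+1) (adic_quot n) (@adic_proj n)
    (@adic_proj_is_monoid n).

Record completion : Type := Completion {
  adic_coord : forall n, adic_quot n;
  adic_coordP : forall n, adic_proj (adic_coord n.+1) = adic_coord n
}.

HB.instance Definition _ := gen_eqMixin completion.
HB.instance Definition _ := gen_choiceMixin completion.

Implicit Types (x y z : completion).

Lemma completion_ext x y : (forall n, adic_coord x n = adic_coord y n) -> x = y.
Proof.
case: x y => [x xP] [y yP] /= xy.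
have {}xy : x = y by exact: functional_extensionality_dep.
by subst y; congr Completion; exact: Prop_irrelevance.
Qed.

Definition completion_of (r : R) : completion :=
  @Completion (fun n => adic_pi n r) (fun n => adic_projE n r).

Program Definition completion_opp x :=
  @Completion (fun n => - adic_coord x n) _.
Next Obligation. by move=> x n /=; rewrite rmorphN /= adic_coordP. Qed.

Program Definition completion_add x y :=
  @Completion (fun n => adic_coord x n + adic_coord y n) _.
Next Obligation. by move=> x y n /=; rewrite rmorphD /= !adic_coordP. Qed.

Program Definition completion_mul x y :=
  @Completion (fun n => adic_coord x n * adic_coord y n) _.
Next Obligation. by move=> x y n /=; rewrite rmorphM /= !adic_coordP. Qed.

Lemma completion_addA : associative completion_add.
Proof. by move=> x y z; apply: completion_ext => n; rewrite /= addrA. Qed.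
Lemma completion_addC : commutative completion_add.
Proof. by move=> x y; apply: completion_ext => n; rewrite /= addrC. Qed.
Lemma completion_add0 : left_id (completion_of 0) completion_add.
Proof. by move=> x; apply: completion_ext => n; rewrite /= rmorph0 add0r. Qed.
Lemma completion_addN :
  left_inverse (completion_of 0) completion_opp completion_add.
Proof. by move=> x; apply: completion_ext => n; rewrite /= rmorph0 addNr. Qed.
HB.instance Definition _ := GRing.isZmodule.Build completion
  completion_addA completion_addC completion_add0 completion_addN.

Lemma completion_mulA : associative completion_mul.
Proof. by move=> x y z; apply: completion_ext => n; rewrite /= mulrA. Qed.
Lemma completion_mulC : commutative completion_mul.
Proof. by move=> x y; apply: completion_ext => n; rewrite /= mulrC. Qed.
Lemma completion_mul1 : left_id (completion_of 1) completion_mul.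
Proof. by move=> x; apply: completion_ext => n; rewrite /= rmorph1 mul1r. Qed.
Lemma completion_mulD : left_distributive completion_mul +%R.
Proof. by move=> x y z; apply: completion_ext => n; rewrite /= mulrDl. Qed.
Lemma completion_nontrivial : completion_of 1 != 0.
Proof.
apply/eqP => /(congr1 (adic_coord^~ 0)) /= /eqP.
by rewrite rmorph1 rmorph0 oner_eq0.
Qed.
HB.instance Definition _ := GRing.Zmodule_isComNzRing.Build completion
  completion_mulA completion_mulC completion_mul1 completion_mulD
  completion_nontrivial.

Lemma completion_of_is_zmod : zmod_morphism completion_of.
Proof. by move=> a b; apply: completion_ext => n; rewrite /= rmorphB. Qed.
Lemma completion_of_is_monoid : monoid_morphism completion_of.
Proof.
by split=> // a b; apply: completion_ext => n; rewrite /= rmorphM.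
Qed.
HB.instance Definition _ :=
  GRing.isZmodMorphism.Build R completion completion_of completion_of_is_zmod.
HB.instance Definition _ :=
  GRing.isMonoidMorphism.Build R completion completion_of
    completion_of_is_monoid.

Definition completion_scale (a : R) x : completion := completion_of a * x.

Lemma completion_scaleA a b x :
  completion_scale a (completion_scale b x) = completion_scale (a * b) x.
Proof. by rewrite /completion_scale mulrA rmorphM. Qed.
Lemma completion_scale1 : left_id 1 completion_scale.
Proof. by move=> x; rewrite /completion_scale rmorph1 mul1r. Qed.
Lemma completion_scaleDr : right_distributive completion_scale +%R.
Proof. by move=> a x y; rewrite /completion_scale mulrDr. Qed.
Lemma completion_scaleDl x :
  {morph completion_scale^~ x : a b / a + b}.
Proof. by move=> a b; rewrite /completion_scale rmorphD mulrDl. Qed.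
HB.instance Definition _ := GRing.Zmodule_isLmodule.Build R completion
  completion_scaleA completion_scale1 completion_scaleDr completion_scaleDl.

Lemma completion_scaleAl (a : R) x y : a *: (x * y) = (a *: x) * y.
Proof. exact: mulrA. Qed.
HB.instance Definition _ :=
  GRing.Lmodule_isLalgebra.Build R completion completion_scaleAl.
HB.instance Definition _ := GRing.Lalgebra_isComAlgebra.Build R completion.

End Completion.

Section DirectSum.
Variables (R : pzRingType) (I : Type) (F : I -> lmodType R).

Record dsum : Type := DSum {
  dsum_coord :> forall i, F i;
  dsum_finsupp : finite_set [set i | dsum_coord i != 0]%classic
}.

HB.instance Definition _ := gen_eqMixin dsum.
HB.instance Definition _ := gen_choiceMixin dsum.

Implicit Types (x y z : dsum).

Lemma dsum_ext x y : (forall i, x i = y i) -> x = y.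
Proof.
case: x y => [x xP] [y yP] /= xy.
have {}xy : x = y by exact: functional_extensionality_dep.
by subst y; congr DSum; exact: Prop_irrelevance.
Qed.

Program Definition dsum_zero := @DSum (fun=> 0) _.
Next Obligation.
by apply: sub_finite_set (finite_set0 I) => i /=; rewrite eqxx.
Qed.

Program Definition dsum_opp x := @DSum (fun i => - x i) _.
Next Obligation.
by move=> x; apply: sub_finite_set (dsum_finsupp x) => i /=; rewrite oppr_eq0.
Qed.

Program Definition dsum_add x y := @DSum (fun i => x i + y i) _.
Next Obligation.
move=> x y.
have xyfin : finite_set ([set i | x i != 0] `|` [set i | y i != 0])%classic.
  by rewrite finite_setU; split; exact: dsum_finsupp.
apply: sub_finite_set xyfin => i /=.
by have [->|? _] := eqVneq (x i) 0; [rewrite add0r; right | left].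
Qed.

Program Definition dsum_scale (a : R) x := @DSum (fun i => a *: x i) _.
Next Obligation.
move=> a x; apply: sub_finite_set (dsum_finsupp x) => i /=.
by apply: contra_neq => ->; rewrite scaler0.
Qed.

Lemma dsum_addA : associative dsum_add.
Proof. by move=> x y z; apply: dsum_ext => i; rewrite /= addrA. Qed.
Lemma dsum_addC : commutative dsum_add.
Proof. by move=> x y; apply: dsum_ext => i; rewrite /= addrC. Qed.
Lemma dsum_add0 : left_id dsum_zero dsum_add.
Proof. by move=> x; apply: dsum_ext => i; rewrite /= add0r. Qed.
Lemma dsum_addN : left_inverse dsum_zero dsum_opp dsum_add.
Proof. by move=> x; apply: dsum_ext => i; rewrite /= addNr. Qed.
HB.instance Definition _ := GRing.isZmodule.Build dsum
  dsum_addA dsum_addC dsum_add0 dsum_addN.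

Lemma dsum_scaleA a b x : dsum_scale a (dsum_scale b x) = dsum_scale (a * b) x.
Proof. by apply: dsum_ext => i; rewrite /= scalerA. Qed.
Lemma dsum_scale1 : left_id 1 dsum_scale.
Proof. by move=> x; apply: dsum_ext => i; rewrite /= scale1r. Qed.
Lemma dsum_scaleDr : right_distributive dsum_scale +%R.
Proof. by move=> a x y; apply: dsum_ext => i; rewrite /= scalerDr. Qed.
Lemma dsum_scaleDl x : {morph dsum_scale^~ x : a b / a + b}.
Proof. by move=> a b; apply: dsum_ext => i; rewrite /= scalerDl. Qed.
HB.instance Definition _ := GRing.Zmodule_isLmodule.Build R dsum
  dsum_scaleA dsum_scale1 dsum_scaleDr dsum_scaleDl.

End DirectSum.

(* M is the cokernel of a linear map R^k -> R^n, given by the matrix A. *)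
Definition finitely_presented (R : pzRingType) (M : lmodType R) : Prop :=
  exists (k n : nat) (A : 'M[R]_(k, n)) (f : {linear 'rV[R]_n -> M}),
    (forall y : M, exists x, f x = y) /\
    (forall x, f x = 0 <-> exists u : 'rV[R]_k, x = u *m A).

Definition pure_projective (R : pzRingType) (P : lmodType R) : Prop :=
  exists (I : Type) (F : I -> lmodType R) (N : lmodType R),
    (forall i, finitely_presented (F i)) /\ lmod_iso (P * N)%type (dsum F).

Section Tensor.
Variables (R : comNzRingType) (M N : lmodType R).

(* [<< (x, y) >>] is the basis element (x, y) of the free R-module on M * N. *)
Variant tensor_rel : set {freeg (M * N) / R} :=
| TensorDl x x' y :
    tensor_rel (<< (x + x', y) >> - << (x, y) >> - << (x', y) >>)
| TensorDr x y y' :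
    tensor_rel (<< (x, y + y') >> - << (x, y) >> - << (x, y') >>)
| TensorZl (a : R) x y : tensor_rel (<< (a *: x, y) >> - a *: << (x, y) >>)
| TensorZr (a : R) x y : tensor_rel (<< (x, a *: y) >> - a *: << (x, y) >>).

Definition tensor : Type := Quotient.quot (submod_span tensor_rel).

HB.instance Definition _ := GRing.Zmodule.on tensor.

Definition tensor_pi (z : {freeg (M * N) / R}) : tensor :=
  \pi_(Quotient.quot (submod_span tensor_rel)) z.

Lemma tensor_pi_is_zmod : zmod_morphism tensor_pi.
Proof. by move=> x y; rewrite /tensor_pi raddfB. Qed.
HB.instance Definition _ := GRing.isZmodMorphism.Build _ _ tensor_pi
  tensor_pi_is_zmod.

Lemma tensor_pi_eq z t :
  tensor_pi z = tensor_pi t <-> z - t \in submod_span tensor_rel.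
Proof. by rewrite Quotient.idealrBE; split => [/eqP|/eqP]. Qed.

Lemma tensor_pi_surj (z : tensor) : tensor_pi (repr z) = z.
Proof. exact: reprK. Qed.

Definition tensor_scale (a : R) (z : tensor) : tensor :=
  tensor_pi (a *: repr z).

Lemma tensor_scaleE a z : tensor_scale a (tensor_pi z) = tensor_pi (a *: z).
Proof.
apply/tensor_pi_eq; rewrite -scalerBr; apply/rpredZ/tensor_pi_eq.
exact: tensor_pi_surj.
Qed.

Lemma tensor_scaleA a b z :
  tensor_scale a (tensor_scale b z) = tensor_scale (a * b) z.
Proof. by rewrite -[z]tensor_pi_surj !tensor_scaleE scalerA. Qed.
Lemma tensor_scale1 : left_id 1 tensor_scale.
Proof. by move=> z; rewrite -[z]tensor_pi_surj !tensor_scaleE scale1r. Qed.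
Lemma tensor_scaleDr : right_distributive tensor_scale +%R.
Proof.
move=> a z t; rewrite -[z]tensor_pi_surj -[t]tensor_pi_surj -raddfD.
by rewrite !tensor_scaleE scalerDr raddfD.
Qed.
Lemma tensor_scaleDl z : {morph tensor_scale^~ z : a b / a + b}.
Proof.
by move=> a b; rewrite -[z]tensor_pi_surj !tensor_scaleE scalerDl raddfD.
Qed.
HB.instance Definition _ := GRing.Zmodule_isLmodule.Build R tensor
  tensor_scaleA tensor_scale1 tensor_scaleDr tensor_scaleDl.

Lemma tensor_pi_is_scalable : scalable tensor_pi.
Proof. by move=> a z; rewrite -tensor_scaleE. Qed.
HB.instance Definition _ := GRing.isScalable.Build R _ _ _ tensor_pi
  tensor_pi_is_scalable.

Definition pure_tensor (x : M) (y : N) : tensor := tensor_pi << (x, y) >>.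

Lemma pure_tensorDl x x' y :
  pure_tensor (x + x') y = pure_tensor x y + pure_tensor x' y.
Proof.
rewrite /pure_tensor -raddfD; apply/tensor_pi_eq/mem_submod_span.
by rewrite opprD addrA; exact: TensorDl.
Qed.

Lemma pure_tensorDr x y y' :
  pure_tensor x (y + y') = pure_tensor x y + pure_tensor x y'.
Proof.
rewrite /pure_tensor -raddfD; apply/tensor_pi_eq/mem_submod_span.
by rewrite opprD addrA; exact: TensorDr.
Qed.

Lemma pure_tensorZl a x y : pure_tensor (a *: x) y = a *: pure_tensor x y.
Proof.
rewrite /pure_tensor -linearZ; apply/tensor_pi_eq/mem_submod_span.
exact: TensorZl.
Qed.

Lemma pure_tensorZr a x y : pure_tensor x (a *: y) = a *: pure_tensor x y.
Proof.
rewrite /pure_tensor -linearZ; apply/tensor_pi_eq/mem_submod_span.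
exact: TensorZr.
Qed.

Lemma tensor_ind (P : tensor -> Prop) :
  P 0 -> (forall x y z, P z -> P (pure_tensor x y + z)) -> forall z, P z.
Proof.
move=> P0 PD z; rewrite -[z]tensor_pi_surj.
elim/freeg_ind_dom0: (repr z) => [|k [x y] D _ _ PDz]; first by rewrite raddf0.
have -> : << k *g (x, y) >> = k *: << (x, y) >> :> {freeg (M * N) / R}.
  by apply/eqP/freeg_eqP => u; rewrite coeffZ !coeffU mul1r.
by rewrite raddfD /= linearZ /= -/(pure_tensor x y) -pure_tensorZl; exact: PD.
Qed.

Definition bilinear_map (W : lmodType R) (f : M -> N -> W) : Prop :=
  [/\ forall x x' y, f (x + x') y = f x y + f x' y,
      forall x y y', f x (y + y') = f x y + f x y',
      forall a x y, f (a *: x) y = a *: f x y &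
      forall a x y, f x (a *: y) = a *: f x y].

Section Lift.
Variables (W : lmodType R) (f : M -> N -> W).

Definition tensor_lift (z : tensor) : W :=
  fglift (fun p : M * N => f p.1 p.2) (repr z).

Hypothesis f_bilin : bilinear_map f.

Let lift := fglift (fun p : M * N => f p.1 p.2).

Let lift_linear : linear lift.
Proof.
have liftB : zmod_morphism lift by exact: lift_is_additive.
pose A : {additive {freeg (M * N) / R} -> W} :=
  HB.pack_for {additive {freeg (M * N) / R} -> W} lift
    (GRing.isZmodMorphism.Build _ _ lift liftB).
have liftD u v : lift (u + v) = lift u + lift v by exact: (raddfD A).
have lift0 : lift 0 = 0 by exact: (raddf0 A).
have liftZ a u : lift (a *: u) = a *: lift u.
  elim/freeg_ind_dom0: u => [|k p D _ _ IHD].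
    by rewrite !scaler0 lift0 scaler0.
  rewrite scalerDr !liftD IHD scalerDr.
  suff -> : a *: << k *g p >> = << a * k *g p >> :> {freeg (M * N) / R}.
    by rewrite /lift !liftU scalerA.
  by apply/eqP/freeg_eqP => q; rewrite coeffZ !coeffU mulrA.
by move=> a u v; rewrite liftD liftZ.
Qed.

Let liftL : {linear {freeg (M * N) / R} -> W} :=
  HB.pack_for {linear {freeg (M * N) / R} -> W} lift
    (GRing.isLinear.Build R _ _ _ lift lift_linear).

Lemma tensor_lift_pi z :
  tensor_lift (tensor_pi z) = fglift (fun p : M * N => f p.1 p.2) z.
Proof.
have [fDl fDr fZl fZr] := f_bilin.
pose K : {freeg (M * N) / R} -> bool := fun u => liftL u == 0.
have inK u : (u \in K) = (liftL u == 0) by [].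
have kerP : GRing.submod_closed K.
  split=> [|a u v]; rewrite !inK; first by rewrite raddf0.
  by rewrite linearP => /eqP-> /eqP->; rewrite scaler0 addr0.
pose ker : submodClosed {freeg (M * N) / R} :=
  HB.pack_for (submodClosed {freeg (M * N) / R}) K
    (GRing.isSubmodClosed.Build R _ _ kerP).
have /tensor_pi_eq/submod_spanP/(_ ker) := tensor_pi_surj (tensor_pi z).
have liftE p : liftL << p >> = f p.1 p.2.
  by rewrite [LHS]liftU scale1r.
suff relK g : tensor_rel g -> g \in ker.
  by move=> /(_ relK); rewrite inK raddfB subr_eq0 => /eqP.
have LB u v : liftL (u - v) = liftL u - liftL v by exact: raddfB.
have LZ a u : liftL (a *: u) = a *: liftL u by exact: linearZ.
case=> *; rewrite inK !(LB, LZ) !liftE /= ?(fDl, fDr, fZl, fZr) ?subrr //.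
  by rewrite -addrA -opprD subrr.
by rewrite -addrA -opprD subrr.
Qed.

Lemma tensor_liftE x y : tensor_lift (pure_tensor x y) = f x y.
Proof. by rewrite tensor_lift_pi liftU scale1r. Qed.

Lemma tensor_lift_linear : linear tensor_lift.
Proof.
move=> a z t; rewrite -[z]tensor_pi_surj -[t]tensor_pi_surj -linearP.
by rewrite !tensor_lift_pi; exact: lift_linear.
Qed.

End Lift.
End Tensor.

Section BaseChange.
Variables (R : comNzRingType) (M : lmodType R) (S : comAlgType R).

Definition base_change : Type := tensor M S.

HB.instance Definition _ := GRing.Zmodule.on base_change.

(* S acts on M (x)_R S through its right factor, see [base_change_scaleE]. *)
Definition base_change_scale (s : S) : base_change -> base_change :=
  tensor_lift (fun (x : M) (t : S) => pure_tensor x (s * t)).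

Lemma base_change_bilinear (s : S) :
  bilinear_map (fun (x : M) (t : S) => pure_tensor x (s * t)).
Proof.
split=> *; rewrite ?mulrDr.
- exact: pure_tensorDl.
- exact: pure_tensorDr.
- exact: pure_tensorZl.
- by rewrite -scalerAr; exact: pure_tensorZr.
Qed.

Lemma base_change_scaleE (s : S) (x : M) (t : S) :
  base_change_scale s (pure_tensor x t) = pure_tensor x (s * t).
Proof. exact: (tensor_liftE (base_change_bilinear s)). Qed.

Lemma base_change_scaleD (s : S) (z z' : tensor M S) :
  base_change_scale s (z + z') =
    (base_change_scale s z + base_change_scale s z' : tensor M S).
Proof.
have := tensor_lift_linear (base_change_bilinear s) 1 z z'.
by rewrite !scale1r.
Qed.

Lemma base_change_scale0 (s : S) :
  base_change_scale s (0 : tensor M S) = 0 :> tensor M S.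
Proof.
by have /eqP := base_change_scaleD s 0 0; rewrite addr0 eq_sym -subr_eq0 addrK
  => /eqP.
Qed.

Lemma base_change_scaleA (s t : S) (z : base_change) :
  base_change_scale s (base_change_scale t z) = base_change_scale (s * t) z.
Proof.
elim/tensor_ind: z => [|x y z IHz]; first by rewrite !base_change_scale0.
by rewrite !base_change_scaleD !base_change_scaleE IHz mulrA.
Qed.
Lemma base_change_scale1 : left_id 1 base_change_scale.
Proof.
elim/tensor_ind => [|x y z IHz]; first by rewrite base_change_scale0.
by rewrite base_change_scaleD base_change_scaleE IHz mul1r.
Qed.
Lemma base_change_scaleDr : right_distributive base_change_scale +%R.
Proof. by move=> s z z'; exact: base_change_scaleD. Qed.
Lemma base_change_scaleDl z : {morph base_change_scale^~ z : s t / s + t}.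
Proof.
move=> s t; elim/tensor_ind: z => [|x y z IHz].
  by rewrite !base_change_scale0 addr0.
rewrite !base_change_scaleD !base_change_scaleE IHz mulrDl pure_tensorDr.
exact: addrACA.
Qed.
HB.instance Definition _ := GRing.Zmodule_isLmodule.Build S base_change
  base_change_scaleA base_change_scale1 base_change_scaleDr
  base_change_scaleDl.

End BaseChange.

(* Main.v *)
From HB Require Import structures.
Require Import Defs.
From mathcomp Require Import all_boot all_algebra.
From mathcomp Require Import boolp classical_sets cardinality.

Set Implicit Arguments.
Unset Strict Implicit.
Unset Printing Implicit Defensive.

Import GRing.Theory.
Local Open Scope ring_scope.

(** Let S be the completion, and suppose that phi : P (x) S -> Q (x) S is an
   isomorphism with inverse psi.  The isomorphism P -> Q is found in two stages.

   Descent to R.  There are R-linear maps f : P -> Q and g : Q -> P that induce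
   the same maps as phi and psi between P / mP and Q / mQ, so that 1 - gf and
   1 - fg have their values in mP and mQ ([inverse_mod]).  Indeed, P is a
   retract of a direct sum of finitely presented modules F, and a linear map
   F -> Q is a solution in Q of a finite homogeneous linear system over R.  The
   map phi provides a solution in Q (x) S; truncating it gives elements of Q
   that solve the system modulo a large power of m, and the Artin-Rees lemma
   [artin_rees] moves them to an exact solution while changing them only by
   elements of mQ ([approximate_hom]).

   Lifting.  Linear maps f and g that are inverse to each other modulo m can be
   replaced by an isomorphism ([lift_iso]).  For finitely generated modules
   this is Nakayama's lemma: 1 - s is invertible if s has its values in mP.  In
   general, P and Q are only locally retracts of finitely generated modules
   ([locally_split]), and Nakayama's lemma allows g to be changed modulo m so
   that gf = 1 on a prescribed finite set ([correct_inverse]).  When P and Q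
   are countably generated, correcting g and f in turn along sequences of
   generators is a back-and-forth construction whose limit is an isomorphism
   ([countable_lift]).

   The uncountable case is reduced to the countable one as in Kaplansky's
   theorem on summands of direct sums of countably generated modules.  Let P
   and Q be retracts of the same direct sum, with index set I.  A subset K of I
   that is closed under the retractions and under f and g cuts out summands P_K
   and Q_K with f(P_K) in Q_K and g(Q_K) in P_K.  Each index lies in a countable
   closed set, because the F_i are finitely generated.  So an isomorphism
   P_K -> Q_K extends to a larger closed set L such that L \ K is countable: the
   complements of P_K in P_L and of Q_K in Q_L are countably generated and f
   and g induce maps between them that are still inverse modulo m
   ([partial_iso_extend]).  Zorn's lemma concludes.

   The converse is the functoriality of base change. *)

(** * Linear maps and submodules *)

Definition lin (R : pzRingType) (U V : lmodType R) (f : U -> V)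
    (fL : linear f) : {linear U -> V} :=
  HB.pack_for {linear U -> V} f (GRing.isLinear.Build R U V *:%R f fL).

Section Submodules.
Variables (R : comNzRingType) (V : lmodType R).

Definition lincomb_closed (A : V -> Prop) : Prop :=
  forall a x y, A x -> A y -> A (a *: x + y).

Section OfSet.
Variables (A : V -> Prop) (A0 : A 0) (AL : lincomb_closed A).

Let subP : GRing.submod_closed (fun x => `[< A x >] : bool).
Proof.
split=> [|a x y /asboolP Ax /asboolP Ay]; first exact/asboolP.
by apply/asboolP; apply: AL.
Qed.

Definition submod_of : submodClosed V :=
  HB.pack_for (submodClosed V) (fun x => `[< A x >])
    (GRing.isSubmodClosed.Build R V _ subP).

Lemma in_submod_of x : x \in submod_of <-> A x.
Proof. by split=> /asboolP. Qed.

End OfSet.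

Lemma span_min (G A : V -> Prop) :
    A 0 -> lincomb_closed A -> (forall g, G g -> A g) ->
  forall x, x \in submod_span G -> A x.
Proof.
move=> A0 AL GA x /submod_spanP/(_ (submod_of A0 AL)) xA.
by apply/(in_submod_of A0 AL)/xA => g Gg; apply/in_submod_of/GA.
Qed.

Lemma span_mono (G H : set V) x :
  (G `<=` H)%classic -> x \in submod_span G -> x \in submod_span H.
Proof.
move=> GH; move: x.
apply: (span_min (A := fun x => x \in submod_span H)) => [|a u v uH vH|g Gg].
- exact: rpred0.
- by rewrite rpredD ?rpredZ.
- exact/mem_submod_span/GH.
Qed.

End Submodules.

Lemma submodB (R : comNzRingType) (V : lmodType R) (A : submodClosed V) x y :
  x \in A -> y \in A -> x - y \in A.
Proof. by move=> xA yA; rewrite -[- y]scaleN1r rpredD ?rpredZ. Qed.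

Section SpanMaps.
Variables (R : comNzRingType) (V W : lmodType R).

Lemma eq_on_span (f g : {linear V -> W}) (G : set V) :
  (forall x, G x -> f x = g x) -> forall x, x \in submod_span G -> f x = g x.
Proof.
move=> fg.
apply: (span_min (A := fun x => f x = g x)) => // [|a x y fgx fgy].
  by rewrite !linear0.
by rewrite !linearP fgx fgy.
Qed.

Lemma span_map (f : {linear V -> W}) (G : set V) (H : set W) :
    (forall x, G x -> f x \in submod_span H) ->
  forall x, x \in submod_span G -> f x \in submod_span H.
Proof.
move=> fG.
apply: (span_min (A := fun x => f x \in submod_span H)) => // [|a x y fx fy].
  by rewrite linear0 rpred0.
by rewrite linearP rpredD ?rpredZ.
Qed.

End SpanMaps.

(** * Multiples of a module by an ideal *)

Section IdealMultiples.
Variables (R : comNzRingType) (I : {pred R}).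

Definition imul_gen (V : lmodType R) : set V :=
  [set x | exists a v, a \in I /\ x = a *: v]%classic.

Definition imul (V : lmodType R) : submodClosed V :=
  submod_span (imul_gen (V := V)).

Lemma mem_imul (V : lmodType R) a (v : V) : a \in I -> a *: v \in imul V.
Proof. by move=> aI; apply: mem_submod_span; exists a, v. Qed.

Lemma imul_map (V W : lmodType R) (f : {linear V -> W}) x :
  x \in imul V -> f x \in imul W.
Proof.
apply: span_map => _ [a [v [aI ->]]].
by rewrite linearZ; apply: mem_imul.
Qed.

Lemma imul_ffun (V : lmodType R) (T : finType) (x : {ffun T -> V}) :
  (forall t, x t \in imul V) -> x \in imul {ffun T -> V}.
Proof.
move=> xI.
pose inj t (v : V) : {ffun T -> V} := [ffun u => if u == t then v else 0].
have injL t : linear (inj t).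
  move=> a u v; apply/ffunP => w; rewrite !ffunE.
  by case: eqP; rewrite ?scaler0 ?addr0.
have -> : x = \sum_t lin (injL t) (x t).
  apply/ffunP => t; rewrite sum_ffunE (bigD1 t) //= big1 ?addr0.
    by rewrite ffunE eqxx.
  by move=> u ut; rewrite ffunE eq_sym (negPf ut).
by apply: rpred_sum => t _; apply: imul_map.
Qed.

End IdealMultiples.

(** * The ascending chain condition *)

Section Acc.
Variable R : comNzRingType.
Implicit Types V W : lmodType R.

Definition acc V : Prop :=
  forall A : nat -> submodClosed V, (forall n, {subset A n <= A n.+1}) ->
  exists n, forall k, (n <= k)%N -> {subset A k <= A n}.

Lemma chain_mono V (A : nat -> submodClosed V) :
    (forall n, {subset A n <= A n.+1}) ->
  forall i j, (i <= j)%N -> {subset A i <= A j}.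
Proof.
move=> AS i j; elim: j => [|j IHj]; first by rewrite leqn0 => /eqP->.
by rewrite leq_eqVlt => /predU1P[->//|/IHj ij] x /ij /AS.
Qed.

Lemma acc_maximal V (P : submodClosed V -> Prop) (A0 : submodClosed V) :
  acc V -> P A0 ->
  exists A, P A /\ forall B, P B -> {subset A <= B} -> {subset B <= A}.
Proof.
move=> accV PA0; apply: contrapT => noMax.
have up (A : {A | P A}) :
    exists B : {A | P A}, {subset sval A <= sval B} /\
                          ~ {subset sval B <= sval A}.
  apply: contrapT => noB; apply: noMax; exists (sval A); split=> [|B PB AB].
    exact: svalP.
  by apply: contrapT => nBA; apply: noB; exists (exist _ B PB).
have [f fP] := choice up.
pose c n := iter n f (exist _ A0 PA0).
have [n|n nP] := accV (fun n => sval (c n)); first exact: (fP (c n)).1.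
exact: (fP (c n)).2 (nP n.+1 (leqnSn n)).
Qed.

Lemma acc_surj V W (f : {linear V -> W}) :
  (forall y, exists x, f x = y) -> acc V -> acc W.
Proof.
move=> fS accV A AS.
have P0 n : f 0 \in A n by rewrite linear0 rpred0.
have PL n : lincomb_closed (fun x => f x \in A n).
  by move=> a x y xA yA; rewrite linearP rpredD ?rpredZ.
have [n x /in_submod_of xA|n nP] := accV (fun n => submod_of (P0 n) (PL n)).
  by apply/in_submod_of/AS.
exists n => k /nP kn y; have [x <-] := fS y.
by move/(in_submod_of (P0 k) (PL k))/kn/in_submod_of.
Qed.

(** A chain in V * W is controlled by its traces on W and its images in V: once
   both are stationary, so is the chain. *)
Lemma acc_prod V W : acc V -> acc W -> acc (V * W)%type.
Proof.
move=> accV accW A AS.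
have X0 n : ((0, 0) : V * W) \in A n by apply: (rpred0 (A n)).
have XL n : lincomb_closed (fun w => ((0, w) : V * W) \in A n).
  move=> a x y xA yA.
  have -> : (0, a *: x + y) = a *: (0, x) + (0, y) :> V * W.
    by congr (_, _); rewrite /= scaler0 addr0.
  by rewrite rpredD ?rpredZ.
have Y0 n : exists w, ((0, w) : V * W) \in A n by exists 0.
have YL n : lincomb_closed (fun v => exists w, ((v, w) : V * W) \in A n).
  move=> a x y [u xA] [v yA]; exists (a *: u + v).
  by apply: (rpredD (_ : a *: (x, u) \in A n) yA); rewrite rpredZ.
have [n w /in_submod_of wA|p pP] := accW (fun n => submod_of (X0 n) (XL n)).
  by apply/in_submod_of/AS.
have [n v /in_submod_of [w vA]|q qP] := accV (fun n => submod_of (Y0 n) (YL n)).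
  by apply/in_submod_of; exists w; apply: AS.
exists (maxn p q) => k; rewrite geq_max => /andP[pk qk] [v w] vwA.
have /(qP k qk)/in_submod_of [w' vw'] : v \in submod_of (Y0 k) (YL k).
  by apply/in_submod_of; exists w.
have vw'm := chain_mono AS (leq_maxr p q) vw'.
have /(pP k pk)/in_submod_of ww' : w - w' \in submod_of (X0 k) (XL k).
  apply/in_submod_of.
  have -> : (0, w - w') = (v, w) - (v, w') :> V * W.
    by congr (_, _); rewrite /= subrr.
  by apply: submodB => //; apply: (chain_mono AS qk).
have -> : (v, w) = (v, w') + (0, w - w') :> V * W.
  by congr (_, _); rewrite /= ?addr0 // addrC subrK.
by apply: rpredD => //; apply: (chain_mono AS (leq_maxl p q)).
Qed.

Lemma acc_ring : noetherian R -> acc R^o.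
Proof.
move=> noeR A AS.
have U0 : exists n, (0 : R^o) \in A n by exists 0%N; rewrite rpred0.
have UL : lincomb_closed (fun x : R^o => exists n, x \in A n).
  move=> a x y [i xA] [j yA]; exists (maxn i j).
  by rewrite rpredD ?rpredZ ?(chain_mono AS (leq_maxl i j) xA)
             ?(chain_mono AS (leq_maxr i j) yA).
have [p [a aP]] := noeR (submod_of U0 UL).
have aA i : exists n, a i \in A n.
  apply/(in_submod_of U0 UL)/aP; exists (fun j => (j == i)%:R).
  rewrite (bigD1 i) //= eqxx mul1r big1 ?addr0 // => j ji.
  by rewrite (negPf ji) mul0r.
have [n nP] := choice aA.
exists (\max_i n i)%N => k _ x xA.
have /aP [c ->] : x \in submod_of U0 UL by apply/in_submod_of; exists k.
apply: rpred_sum => i _.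
by apply/(@rpredZ R R^o)/(chain_mono AS _ (nP i))/leq_bigmax.
Qed.

Lemma acc_rV : noetherian R -> forall n, acc 'rV[R]_n.
Proof.
move=> noeR; elim=> [|n IHn].
  move=> A _; exists 0%N => k _ x _.
  by have -> : x = 0 :> 'rV[R]_0; [apply/rowP; case | apply: (rpred0 (A 0%N))].
have jL : linear (fun u : R^o * 'rV[R]_n => row_mx (u.1%:M : 'rV_1) u.2).
  move=> a u v; rewrite scale_row_mx add_row_mx; congr row_mx.
  by rewrite /= raddfD /= scale_scalar_mx.
apply: (@acc_surj _ 'rV[R]_(1 + n) (lin jL)) => [y|].
  exists (lsubmx y 0 0, rsubmx y); rewrite -[RHS]hsubmxK /=; congr row_mx.
  by rewrite [RHS]mx11_scalar.
by apply: acc_prod => //; apply: acc_ring.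
Qed.

Definition fin_gen V : Prop :=
  exists n (f : {linear 'rV[R]_n -> V}), forall y, exists x, f x = y.

Lemma fin_gen_acc V : noetherian R -> fin_gen V -> acc V.
Proof. by move=> noeR [n [f /acc_surj]]; apply; apply: acc_rV. Qed.

Lemma fin_gen_prod V W : fin_gen V -> fin_gen W -> fin_gen (V * W)%type.
Proof.
move=> [p [f fS]] [q [g gS]].
have hL : linear (fun x : 'rV[R]_(p + q) => (f (lsubmx x), g (rsubmx x))).
  by move=> a x y; rewrite !linearP.
exists (p + q)%N, (lin hL) => -[v w].
have [x xv] := fS v; have [y yw] := gS w.
by exists (row_mx x y); rewrite /= row_mxKl row_mxKr xv yw.
Qed.

Lemma acc_ffun V k : acc V -> acc {ffun 'I_k -> V}.
Proof.
move=> accV; elim: k => [|k IHk].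
  move=> A _; exists 0%N => n _ x _.
  have -> : x = 0 by apply/ffunP; case.
  exact: (rpred0 (A 0%N)).
pose j (u : V * {ffun 'I_k -> V}) : {ffun 'I_k.+1 -> V} :=
  [ffun i => if unlift ord0 i is Some i' then u.2 i' else u.1].
have jL : linear j.
  move=> a u v; apply/ffunP => i; rewrite !ffunE.
  by case: (unlift ord0 i) => [i'|] //=; rewrite !ffunE.
apply: (@acc_surj _ _ (lin jL)) (acc_prod accV IHk) => y.
exists (y ord0, [ffun i => y (lift ord0 i)]); apply/ffunP => i.
by rewrite /= ffunE; case: unliftP => [i' ->|->]; rewrite //= ffunE.
Qed.

(** Let the kernels of the powers of t be stationary from n on.  An element of
   the kernel of t is t^n z for some z; then z is killed by t^(n+1), hence
   by t^n. *)
Lemma acc_surj_inj V (t : {linear V -> V}) :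
  acc V -> (forall y, exists x, t x = y) -> injective t.
Proof.
move=> accV tS.
have K0 n : iter n t 0 = 0 by elim: n => //= n ->; rewrite linear0.
have KL n : lincomb_closed (fun x => iter n t x = 0).
  move=> a x y; suff -> : iter n t (a *: x + y) = a *: iter n t x + iter n t y.
    by move=> -> ->; rewrite scaler0 addr0.
  by elim: n => //= n ->; rewrite linearP.
have [n x /in_submod_of /= xn|n nP] := accV (fun n => submod_of (K0 n) (KL n)).
  by apply/(in_submod_of (K0 n.+1) (KL n.+1)); rewrite iterS xn linear0.
have tnS y : exists x, iter n t x = y.
  elim: n y {nP} => [|n IHn] y; first by exists y.
  by have [z <-] := tS y; have [x <-] := IHn z; exists x.
move=> x y /eqP; rewrite -subr_eq0 -linearB => /eqP txy; apply/eqP.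
rewrite -subr_eq0; apply/eqP; have [z zxy] := tnS (x - y).
have : z \in submod_of (K0 n) (KL n).
  by apply: (nP n.+1 (leqnSn n)); apply/in_submod_of; rewrite iterS zxy.
by move/in_submod_of; rewrite zxy.
Qed.

End Acc.

(** * A weak Artin-Rees lemma *)

Section ArtinRees.
Variables (R : comNzRingType) (m : idealr R).
Hypothesis noeR : noetherian R.

Lemma idealr_fg : exists p (x : 'I_p -> R), (forall i, x i \in m) /\
  forall a, a \in m -> exists c : 'I_p -> R, a = \sum_i c i * x i.
Proof.
have m0 : (0 : R^o) \in m by exact: rpred0.
have mL : lincomb_closed (fun a : R^o => a \in m).
  move=> a u v um vm; rewrite rpredD // [_ *: _]mulrC mulrC; exact: idealMr.
have [p [x xP]] := noeR (submod_of m0 mL).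
exists p, x; split=> [i|a am]; last by apply/xP/(in_submod_of m0 mL).
apply/(in_submod_of m0 mL)/xP; exists (fun j => (j == i)%:R).
rewrite (bigD1 i) //= eqxx mul1r big1 ?addr0 // => j ji.
by rewrite (negPf ji) mul0r.
Qed.

(** The use of monomials is that one of degree larger than p * M in p variables
   is divisible by the (M+1)-st power of a variable. *)
Lemma ideal_pow_monomials p (x : 'I_p -> R) N a :
    (forall a, a \in m -> exists c : 'I_p -> R, a = \sum_i c i * x i) ->
    a \in ideal_pow m N ->
  a \in @submod_span R R^o [set \prod_i x i ^+ e i |
    e in [set e : 'I_p -> nat | \sum_i e i = N]%N]%classic.
Proof.
move=> xP; elim: N a => [|N IHN] a.
  move=> _; rewrite -[a]mulr1; apply: (@rpredZ R R^o); apply: mem_submod_span.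
  by exists (fun=> 0%N); [rewrite /= big1 | rewrite big1].
rewrite ideal_powS; move: a; apply: (span_min (A := fun a : R^o => a \in _)).
- exact: rpred0.
- by move=> c u v uS vS; rewrite rpredD ?rpredZ.
move=> _ [b [d [/xP [c ->] /IHN dS ->]]]; move: d dS.
apply: (span_min (A := fun d : R^o => _ * d \in _)).
- by rewrite mulr0; exact: rpred0.
- move=> r u v uS vS; rewrite mulrDr rpredD //.
  by rewrite -[r *: u]/(r * u) mulrCA; apply: (@rpredZ R R^o).
move=> _ [e /= eN <-]; rewrite mulr_suml; apply: rpred_sum => i _.
rewrite -mulrA; apply: (@rpredZ R R^o); apply: mem_submod_span.
exists (fun j => (e j + (j == i))%N) => /=.
  rewrite big_split /= eN (bigD1 i) //= eqxx big1 ?addn0 ?addn1 //.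
  by move=> j /negPf->.
rewrite (bigD1 i) //= eqxx [in RHS](bigD1 i) //= addn1 exprS -!mulrA.
by congr (_ * (_ * _)); apply: eq_bigr => j /negPf->; rewrite addn0.
Qed.

(** Krull's argument: choose C maximal among the submodules of W that contain
   T(mV) and meet T(V) in T(mV) only.  For x in m, the submodules
   {w | x^k w in C} are stationary from some n on, and then C + x^n W also meets
   T(V) in T(mV) only: if b = c + x^n u is in T(V), then x b is in T(mV), so
   x^(n+1) u is in C, hence x^n u and b are in C.  By maximality C contains
   x^n W.  As m is finitely generated, C contains m^N W for some N. *)
Lemma artin_rees (V W : lmodType R) (T : {linear V -> W}) : acc W ->
  exists N, forall v, T v \in imul (ideal_pow m N) W ->
    exists2 z, z \in imul m V & T z = T v.
Proof.
move=> accW.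
have B0 : exists2 z, z \in imul m V & T z = 0.
  by exists 0; rewrite ?linear0 ?rpred0.
have BL : lincomb_closed (fun w => exists2 z, z \in imul m V & T z = w).
  move=> a _ _ [u um <-] [v vm <-].
  by exists (a *: u + v); rewrite ?linearP ?rpredD ?rpredZ.
pose B := submod_of B0 BL.
have [|C [[BC CT] Cmax]] := acc_maximal
  (P := fun C => {subset B <= C} /\ forall v, T v \in C -> T v \in B)
  (A0 := B) accW.
  by split.
have powC (x : R) : x \in m -> exists n, forall w, x ^+ n *: w \in C.
  move=> xm.
  have K0 k : x ^+ k *: 0 \in C by rewrite scaler0 rpred0.
  have KL k : lincomb_closed (fun w => x ^+ k *: w \in C).
    move=> a u v uC vC.
    rewrite scalerDr scalerA mulrC -scalerA.
    by apply: rpredD => //; apply: rpredZ.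
  have [k w /in_submod_of wC|n nP] := accW (fun k => submod_of (K0 k) (KL k)).
    by apply/in_submod_of; rewrite exprS -scalerA rpredZ.
  have D0 : exists c u, c \in C /\ 0 = c + x ^+ n *: u.
    by exists 0, 0; rewrite rpred0 scaler0 addr0.
  have DL :
      lincomb_closed (fun w => exists c u, c \in C /\ w = c + x ^+ n *: u).
    move=> a _ _ [c [u [cC ->]]] [d [v [dC ->]]].
    exists (a *: c + d), (a *: u + v).
    split; first by rewrite rpredD ?rpredZ.
    by rewrite !scalerDr addrACA !scalerA [a * _]mulrC.
  have CD : {subset C <= submod_of D0 DL}.
    by move=> c cC; apply/in_submod_of; exists c, 0; rewrite scaler0 addr0.
  exists n => w; apply: (Cmax (submod_of D0 DL)) => //; last first.
    by apply/in_submod_of; exists 0, w; rewrite rpred0 add0r.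
  split=> [b /BC /CD //|v /in_submod_of [c [u [cC Tv]]]].
  apply: CT; rewrite Tv rpredD //.
  suff /(nP n.+1 (leqnSn n)) : u \in submod_of (K0 n.+1) (KL n.+1).
    by move/in_submod_of.
  apply/in_submod_of; rewrite exprS -scalerA.
  have -> : x *: (x ^+ n *: u) = x *: T v - x *: c.
    by rewrite Tv scalerDr addrC addKr.
  apply: submodB; last exact: rpredZ.
  apply: BC; apply/in_submod_of; exists (x *: v); last by rewrite linearZ.
  exact: mem_imul.
have [p [x [xm xP]]] := idealr_fg.
have [n nP] := choice (fun i => powC (x i) (xm i)).
pose M := (\max_i n i)%N.
exists (p * M).+1 => v vN; apply/(in_submod_of B0 BL)/CT; move: vN.
apply: (span_min (A := fun w => w \in C)) => [||_ [a [w [aN ->]]]].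
- exact: rpred0.
- by move=> a u u' uC uC'; rewrite rpredD ?rpredZ.
have {aN} := ideal_pow_monomials xP aN; move: a.
apply: (span_min (A := fun a : R^o => (a : R) *: w \in C)).
- by rewrite scale0r rpred0.
- move=> a u u' uC u'C; rewrite scalerDl -scalerA.
  by apply: rpredD => //; apply: rpredZ.
move=> _ [e /= eN <-].
(* All exponents at most M would make the degree at most p * M. *)
have [i Mi] : exists i, (M < e i)%N.
  apply: contrapT => noi; have : (\sum_(i < p) e i <= \sum_(i < p) M)%N.
    apply: leq_sum => i _; rewrite leqNgt; apply/negP => Mi.
    by apply: noi; exists i.
  by rewrite eN sum_nat_const card_ord ltnn.
have nei : (n i <= e i)%N by rewrite (leq_trans (leq_bigmax i)) // ltnW.
rewrite (bigD1 i) //= -(subnKC nei) exprD mulrC mulrCA -scalerA.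
exact: nP.
Qed.

End ArtinRees.

(** * Nakayama's lemma *)

Section Nakayama.
Variables (R : comNzRingType) (m : idealr R).
Hypotheses (noeR : noetherian R) (locR : local_with m).

(** Otherwise 1 - a would lie in some maximal ideal, that is, in m, which
   contains a. *)
Lemma local_unit a : a \in m -> exists b, b * (1 - a) = 1.
Proof.
move=> am; apply: contrapT => nunit.
have I0 : exists r : R, (0 : R^o) = r * (1 - a) by exists 0; rewrite mul0r.
have IL : lincomb_closed (fun x : R^o => exists r, x = r * (1 - a)).
  move=> c _ _ [r ->] [s ->]; exists (c * r + s).
  by rewrite mulrDl -mulrA.
pose P (J : submodClosed R^o) := 1 - a \in J /\ 1 \notin J.
have [||J [[aJ J1] Jmax]] := acc_maximal (P := P) (A0 := submod_of I0 IL).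
- exact: acc_ring.
- split; first by apply/(in_submod_of I0 IL); exists 1; rewrite mul1r.
  by apply/negP => /(in_submod_of I0 IL) [r r1]; apply: nunit; exists r.
pose Jb (x : R) : bool := x \in J.
have JP : idealr_closed Jb.
  split=> [||c u v uJ vJ]; [exact: (rpred0 J)|exact: J1|].
  by apply: (rpredD (_ : c * u \in J) vJ); apply: (@rpredZ R R^o).
pose J' : idealr R := HB.pack_for (idealr R) Jb (isIdealr.Build R Jb JP).
have JM : maximal_ideal J'.
  move=> L JL x; apply/idP/idP; last exact: JL.
  have L0 : (0 : R^o) \in L by exact: rpred0.
  have LL : lincomb_closed (fun x : R^o => x \in L).
    move=> c u v uL vL; rewrite rpredD // [_ *: _]mulrC mulrC.
    exact: idealMr.
  have := Jmax (submod_of L0 LL); move=> /(_ _ _ x) H xL; apply: H.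
  - split; first by apply/(in_submod_of L0 LL)/JL.
    by apply/negP => /(in_submod_of L0 LL); rewrite idealr1.
  - by move=> y yJ; apply/(in_submod_of L0 LL)/JL.
  - exact/(in_submod_of L0 LL).
have aJm : 1 - a \in m by rewrite -(locR.2 J' JM).
by have := rpredD aJm am; rewrite subrK idealr1.
Qed.

(** The determinant of 1 - M is 1 modulo m, hence a unit. *)
Lemma det_one_sub n (M : 'M[R]_n) : (forall i j, M i j \in m) ->
  exists N : 'M[R]_n, N *m (1%:M - M) = 1%:M.
Proof.
move=> Mm.
have [b bP] : exists b, b * \det (1%:M - M) = 1.
  suff dm : 1 - \det (1%:M - M) \in m.
    by have [b] := local_unit dm; rewrite opprB addrC subrK => ?; exists b.
  pose pi : {rmorphism R -> {ideal_quot m}} := \pi_({ideal_quot m})%qT.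
  have pi_eq x y : (pi x = pi y) <-> (x - y \in m).
    by rewrite Quotient.idealrBE; split=> /eqP.
  apply/pi_eq; rewrite rmorph1 -det_map_mx.
  suff -> : map_mx pi (1%:M - M) = 1%:M by rewrite det1.
  rewrite map_mxB map_mx1 (_ : map_mx pi M = 0) ?subr0 //.
  apply/matrixP => i j; rewrite !mxE -(rmorph0 pi); apply/pi_eq.
  by rewrite subr0.
exists (b *: \adj (1%:M - M)).
by rewrite -scalemxAl mul_adj_mx scale_scalar_mx bP.
Qed.

Lemma imul_fin_gen (E : lmodType R) n (f : {linear 'rV[R]_n -> E}) y :
    (forall y, exists x, f x = y) -> y \in imul m E ->
  exists c : 'rV[R]_n, (forall i, c 0 i \in m) /\ f c = y.
Proof.
move=> fS; move: y.
apply: (span_min (A := fun y => exists c : 'rV[R]_n,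
  (forall i, c 0 i \in m) /\ f c = y)).
- by exists 0; split=> [i|]; rewrite ?linear0 // mxE rpred0.
- move=> a _ _ [c [cm <-]] [d [dm <-]]; exists (a *: c + d).
  split=> [i|]; last by rewrite linearP.
  by rewrite !mxE rpredD // mulrC mulrC; exact: idealMr.
move=> _ [a [v [am ->]]]; have [x <-] := fS v; exists (a *: x).
by split=> [i|]; rewrite ?linearZ // mxE mulrC; exact: idealMr.
Qed.

(** On generators of E, the map h is given by a matrix with entries in m, so
   1 - h is surjective; it is injective since E is noetherian. *)
Lemma one_sub_linv (E : lmodType R) (h : {linear E -> E}) :
    fin_gen E -> (forall x, h x \in imul m E) ->
  exists v : {linear E -> E}, forall x, v (x - h x) = x.
Proof.
move=> fgE hm; have [n [f fS]] := fgE.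
have [c cP] := choice (fun i => imul_fin_gen fS (hm (f (delta_mx 0 i)))).
pose M := \matrix_(i, j) c i 0 j.
have [N NM] : exists N, N *m (1%:M - M) = 1%:M.
  by apply: det_one_sub => i j; rewrite mxE; apply: (cP i).1.
have fM u : f (u *m M) = h (f u).
  rewrite mulmx_sum_row [in RHS](row_sum_delta u) !linear_sum.
  apply: eq_bigr => i _; rewrite !linearZ /=; congr (_ *: _).
  by rewrite -(cP i).2; congr (f _); apply/rowP => j; rewrite !mxE.
have tL : linear (fun x => x - h x).
  by move=> a x y; rewrite linearP scalerBr opprD addrACA.
have tS y : exists x, lin tL x = y.
  have [u <-] := fS y; exists (f (u *m N)).
  rewrite /= -fM -linearB; congr (f _).
  by rewrite -{1}[u *m N]mulmx1 -mulmxBr -mulmxA NM mulmx1.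
have tI := acc_surj_inj (fin_gen_acc noeR fgE) tS.
have [v vP] := choice tS.
have vL : linear v by move=> a x y; apply: tI; rewrite vP linearP !vP.
by exists (lin vL) => x; apply: tI; rewrite vP.
Qed.

End Nakayama.

(** * Lifting isomorphisms modulo the maximal ideal: the countable case *)

(** The only trace of pure-projectivity used in the back-and-forth argument:
   finite subsets cannot tell P from a retract of a finitely generated
   module. *)
Definition locally_split (R : comNzRingType) (P : lmodType R) : Prop :=
  forall X : seq P, exists (E : lmodType R) (a : {linear P -> E})
    (b : {linear E -> P}), fin_gen E /\ {in X, forall x, b (a x) = x}.

Definition countably_generated (R : comNzRingType) (P : lmodType R) : Prop :=
  exists x : nat -> P, forall y, y \in submod_span (range x).

Lemma locally_split_retract (R : comNzRingType) (P C : lmodType R)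
    (i : {linear C -> P}) (r : {linear P -> C}) :
  cancel i r -> locally_split P -> locally_split C.
Proof.
move=> iK lsP X; have [E [a [b [fgE abX]]]] := lsP (map i X).
exists E, (a \o i), (r \o b); split=> // x xX /=.
by rewrite abX ?iK // map_f.
Qed.

Section BackAndForth.
Variables (R : comNzRingType) (m : idealr R).
Hypotheses (noeR : noetherian R) (locR : local_with m).

Definition inverse_mod (P Q : lmodType R) (f : {linear P -> Q})
    (g : {linear Q -> P}) : Prop :=
  (forall x, x - g (f x) \in imul m P) /\ (forall y, y - f (g y) \in imul m Q).

Lemma inverse_mod_sym (P Q : lmodType R) (f : {linear P -> Q})
  (g : {linear Q -> P}) : inverse_mod f g -> inverse_mod g f.
Proof. by case. Qed.

(** Write gf = 1 - s with s(P) in mP, take a : P -> E and b : E -> P with ba = 1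
   on X, and let v be a left inverse of 1 - asb.  Then u = 1 + sbva inverts
   1 - s on X.  Indeed, if bax = x, then a(1 - s)x = (1 - asb)ax is sent to ax
   by v, so that u(1 - s)x = (1 - s)x + s(bax) = x.  The new map is ug, which is
   g modulo m. *)
Lemma correct_inverse (P Q : lmodType R) (f : {linear P -> Q})
    (g : {linear Q -> P}) (X : seq P) :
    locally_split P -> inverse_mod f g ->
  exists2 g' : {linear Q -> P}, inverse_mod f g' &
    {in X, forall x, g' (f x) = x}.
Proof.
move=> lsP [gf fg]; have [E [a [b [fgE baX]]]] := lsP X.
have sL : linear (fun x => x - g (f x)).
  by move=> r x y; rewrite (linearP f) (linearP g) scalerBr opprD addrACA.
pose s := lin sL.
have [|v vP] := one_sub_linv (h := a \o s \o b) noeR locR fgE.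
  by move=> e; exact: imul_map a _ (gf (b e)).
have uL : linear (fun x => x + s (b (v (a x)))).
  move=> r x y; rewrite (linearP a) (linearP v) (linearP b) (linearP s).
  by rewrite [in RHS]scalerDr [RHS]addrACA.
exists (lin uL \o g) => [|x xX /=].
  split=> [x|y] /=.
    by rewrite opprD addrA submodB.
  rewrite linearD opprD addrA submodB //.
  by apply: imul_map; apply: gf.
have -> : g (f x) = x - s x by rewrite /= opprB addrC subrK.
have -> : a (x - s x) = a x - (a \o s \o b) (a x).
  by rewrite /= baX // linearB.
by rewrite vP baX // subrK.
Qed.

(** A state consists of f, g and a finite set X on which gf = 1.  One step first
   corrects f into f' such that f'g = 1 on f(X) and on the next generator of Q;
   this does not change f on X, because f'x = f'(g(f x)) = f x there.  It then
   corrects g into g' such that g'f' = 1 on X, on the next generator of P and on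
   a preimage of the next generator of Q.  Hence the successive f have a limit;
   it is injective because each of them is injective on its own X, and it is
   surjective because it reaches the generators of Q. *)
Lemma countable_lift (P Q : lmodType R) (f0 : {linear P -> Q})
    (g0 : {linear Q -> P}) :
    locally_split P -> locally_split Q ->
    countably_generated P -> countably_generated Q ->
  inverse_mod f0 g0 -> lmod_iso P Q.
Proof.
move=> lsP lsQ [xs xsP] [ys ysP] fg0.
pose T := ({linear P -> Q} * {linear Q -> P} * seq P)%type.
pose valid (t : T) := inverse_mod t.1.1 t.1.2 /\
  {in t.2, forall x, t.1.2 (t.1.1 x) = x}.
pose extends n (t t' : T) := [/\ {subset t.2 <= t'.2},
  {in t.2, t'.1.1 =1 t.1.1}, xs n \in t'.2 &
  exists2 x, x \in t'.2 & t'.1.1 x = ys n].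
have step (nt : nat * {t | valid t}) :
    exists t' : {t | valid t}, extends nt.1 (sval nt.2) (sval t').
  case: nt => n [[[f g] X] [/= fg gfX]].
  have [f' gf' fgY] :=
    correct_inverse (ys n :: map f X) lsQ (inverse_mod_sym fg).
  (* As f'(g (ys n)) = ys n, the second entry is a preimage of ys n. *)
  pose X' := xs n :: g (ys n) :: X.
  have [g' f'g' gfX'] := correct_inverse X' lsP (inverse_mod_sym gf').
  exists (exist _ (f', g', X') (conj f'g' gfX')); split=> /=.
  - by move=> x xX; rewrite !inE xX !orbT.
  - by move=> x xX; rewrite -{1}(gfX x xX) fgY // inE map_f ?orbT.
  - by rewrite inE eqxx.
  - by exists (g (ys n)); rewrite ?fgY ?inE ?eqxx ?orbT.
have [next nextP] := choice step.
have v0 : valid (f0, g0, [::]) by [].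
pose c := fix c n := if n is n'.+1 then next (n', c n') else exist _ _ v0.
pose F n := (sval (c n)).1.1; pose G n := (sval (c n)).1.2.
pose X n : set P := [set` (sval (c n)).2]%classic.
have cP n : extends n (sval (c n)) (sval (c n.+1)) by apply: (nextP (n, c n)).
have XS i j : (i <= j)%N -> (X i `<=` X j)%classic.
  elim: j => [|j IHj]; first by rewrite leqn0 => /eqP->.
  rewrite leq_eqVlt => /predU1P[->//|/IHj ij] x /ij.
  by case: (cP j) => + _ _ _; apply.
have FS i j : (i <= j)%N -> forall x, x \in submod_span (X i) -> F j x = F i x.
  move=> ij; apply: eq_on_span => x Xx; elim: j ij => [|j IHj].
    by rewrite leqn0 => /eqP->.
  rewrite leq_eqVlt => /predU1P[->//|ij]; rewrite -IHj //.
  by case: (cP j) => _ H _ _; exact: (H x (XS i j ij x Xx)).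
have GF n x : x \in submod_span (X n) -> G n (F n x) = x.
  move: x; apply: (eq_on_span (f := G n \o F n) (g := idfun)) => x Xx /=.
  exact: (svalP (c n)).2.
have sXS i j x :
    (i <= j)%N -> x \in submod_span (X i) -> x \in submod_span (X j).
  by move=> ij; apply: span_mono; apply: XS.
have xX x : exists n, x \in submod_span (X n).
  move: x (xsP x); apply: (span_min (A := fun x => exists n, _)).
  - by exists 0%N; rewrite rpred0.
  - move=> a x y [i xi] [j yj]; exists (maxn i j).
    by rewrite rpredD ?rpredZ ?(sXS _ _ _ (leq_maxl i j) xi)
               ?(sXS _ _ _ (leq_maxr i j) yj).
  - move=> _ [n _ <-]; exists n.+1; apply: mem_submod_span.
    by case: (cP n).
have [N NP] := choice xX.
pose H x := F (N x) x.
have HE n x : x \in submod_span (X n) -> H x = F n x.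
  move=> xn; case: (leqP n (N x)) => [nN|/ltnW nN]; first exact: FS.
  by rewrite /H (FS _ _ nN).
have HL : linear H.
  move=> a x y; pose n := maxn (N x) (N y).
  have xn : x \in submod_span (X n) by apply: sXS (NP x); exact: leq_maxl.
  have yn : y \in submod_span (X n) by apply: sXS (NP y); exact: leq_maxr.
  by rewrite (HE n x) // (HE n y) // (HE n) ?linearP // rpredD ?rpredZ.
have HI x : H x = 0 -> x = 0.
  by move=> Hx; rewrite -(GF _ _ (NP x)) -/(H x) Hx linear0.
have HS y : exists x, H x = y.
  move: y (ysP y); apply: (span_min (A := fun y => exists x, H x = y)).
  - by exists 0; exact: (linear0 (lin HL)).
  - by move=> a _ _ [x <-] [y <-]; exists (a *: x + y); rewrite HL.
  - move=> _ [n _ <-]; case: (cP n) => _ _ _ [x xX' xy]; exists x.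
    by rewrite (HE n.+1) //; apply: mem_submod_span.
have [K KP] := choice HS.
exists (lin HL), K => [x|] //=.
apply/eqP; rewrite -subr_eq0; apply/eqP; apply: HI.
rewrite [LHS](linearB (lin HL)); apply/eqP; rewrite subr_eq0; apply/eqP.
exact: KP.
Qed.

End BackAndForth.

(** * Direct sums *)

Section DirectSums.
Variables (R : comNzRingType) (I : Type) (F : I -> lmodType R).

Lemma dsum_inj_finsupp i (u : F i) : finite_set [set j |
  (if pselect (i = j) is left e then eq_rect i (fun k => F k : Type) u j e
   else 0) != 0]%classic.
Proof.
apply: sub_finite_set (finite_set1 i) => j /=.
by case: pselect => [ij _|_]; [exact: esym ij | rewrite eqxx].
Qed.

(** Equality of indices is decided classically; u is transported along it. *)
Definition dsum_inj i (u : F i) : dsum F := DSum (dsum_inj_finsupp u).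

Lemma dsum_inj_same i (u : F i) : dsum_inj u i = u.
Proof.
rewrite /=; case: pselect => // e.
by rewrite (Prop_irrelevance e erefl).
Qed.

Lemma dsum_inj_other i j (u : F i) : i <> j -> dsum_inj u j = 0.
Proof. by rewrite /=; case: pselect. Qed.

Lemma dsum_linearE a (x y : dsum F) i : (a *: x + y) i = a *: x i + y i.
Proof. by []. Qed.

Lemma dsum_subE (x y : dsum F) i : (x - y) i = x i - y i.
Proof. by []. Qed.

Lemma dsum_inj_linear i : linear (@dsum_inj i).
Proof.
move=> a u v; apply: dsum_ext => j; case: (pselect (i = j)) => [<-|ij].
  by rewrite dsum_linearE !dsum_inj_same.
by rewrite dsum_linearE !dsum_inj_other // scaler0 addr0.
Qed.

Lemma dsum_inj0 i : dsum_inj (0 : F i) = 0.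
Proof. exact: (linear0 (lin (@dsum_inj_linear i))). Qed.

Lemma dsum_injZ i a (u : F i) : dsum_inj (a *: u) = a *: dsum_inj u.
Proof. by rewrite -[a *: u]addr0 dsum_inj_linear dsum_inj0 addr0. Qed.

(** Listing the support needs an equality test on I; the alias {classic I} of I
   carries one. *)
Lemma dsum_supp_seq (x : dsum F) :
  exists s : seq {classic I}, uniq s /\
    forall i : {classic I}, x i != 0 -> i \in s.
Proof.
have /(@finite_seqP {classic I}) [s sP] := dsum_finsupp x.
exists (undup s); split=> [|i xi]; first exact: undup_uniq.
by rewrite mem_undup; have : [set` s]%classic i by rewrite -sP.
Qed.

Lemma dsum_sub_inj (x : dsum F) (s : seq {classic I}) (i : {classic I}) :
    (forall j : {classic I}, x j != 0 -> j \in i :: s) ->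
  forall j : {classic I}, (x - dsum_inj (x i)) j != 0 -> j \in s /\ x j != 0.
Proof.
move=> xs j; rewrite dsum_subE; case: (pselect (i = j :> I)) => [ij|ij].
  by case: _ / ij; rewrite dsum_inj_same subrr eqxx.
rewrite dsum_inj_other // subr0 => xj; split=> //.
by have := xs _ xj; rewrite inE => /predU1P[ji|//]; case: ij.
Qed.

Lemma dsum_ind (A : dsum F -> Prop) (x : dsum F) :
    A 0 -> lincomb_closed A -> (forall i, x i != 0 -> A (dsum_inj (x i))) ->
  A x.
Proof.
move=> A0 AL; have [s [_]] := dsum_supp_seq x.
elim: s x => [|i s IHs] x xs xA.
  have -> // : x = 0.
  by apply: dsum_ext => i; apply/eqP/negPn/negP => /xs.
have yP := dsum_sub_inj xs.
have Ay : A (x - dsum_inj (x i)).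
  apply: IHs => [j /yP[] //|j yj].
  have -> : (x - dsum_inj (x i)) j = x j.
    rewrite dsum_subE dsum_inj_other ?subr0 // => ij.
    move: yj; rewrite dsum_subE.
    by case: _ / ij; rewrite dsum_inj_same subrr eqxx.
  by apply: xA; case: (yP j yj).
have [xi|/xA Ai] := eqVneq (x i) 0.
  by move: Ay; rewrite xi dsum_inj0 subr0.
by have := AL 1 _ _ Ai Ay; rewrite scale1r addrC subrK.
Qed.

Lemma dsum_map_ext (W : lmodType R) (f g : {linear dsum F -> W}) :
  (forall i (u : F i), f (dsum_inj u) = g (dsum_inj u)) -> f =1 g.
Proof.
move=> fg x; apply: (dsum_ind (A := fun x => f x = g x)) => // [|a u v fu fv].
  by rewrite !linear0.
by rewrite !linearP fu fv.
Qed.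

Section Lift.
Variables (W : lmodType R) (h : forall i, {linear F i -> W}).

Let total (s : seq {classic I}) (x : dsum F) := \sum_(i <- s) h i (x i).

Let total_indep (s t : seq {classic I}) (x : dsum F) :
    uniq s -> uniq t ->
    (forall i : {classic I}, x i != 0 -> i \in s) ->
    (forall i : {classic I}, x i != 0 -> i \in t) ->
  total s x = total t x.
Proof.
have supp r : total r x = \sum_(i <- [seq i <- r | x i != 0]) h i (x i).
  rewrite big_filter [RHS]big_mkcond; apply: eq_bigr => i _.
  by case: eqVneq => // ->; rewrite linear0.
move=> us ut xs xt; rewrite !supp.
apply: (@perm_big _ _ _ {classic I}).
apply: uniq_perm; rewrite ?filter_uniq // => i; rewrite !mem_filter.
by case: eqVneq => //= /[dup] /xs -> /xt ->.
Qed.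

Lemma dsum_lift : exists g : {linear dsum F -> W},
  forall i (u : F i), g (dsum_inj u) = h i u.
Proof.
have [S SP] := choice dsum_supp_seq.
have gL : linear (fun x => total (S x) x).
  move=> a x y; pose s := undup (S x ++ S y).
  have us : uniq s by exact: undup_uniq.
  have xs (i : {classic I}) : x i != 0 -> i \in s.
    by move/(SP x).2; rewrite mem_undup mem_cat => ->.
  have ys (i : {classic I}) : y i != 0 -> i \in s.
    by move/(SP y).2; rewrite mem_undup mem_cat orbC => ->.
  rewrite (total_indep (SP x).1 us (SP x).2 xs).
  rewrite (total_indep (SP y).1 us (SP y).2 ys).
  rewrite (total_indep (SP _).1 us (SP _).2).
    rewrite /total scaler_sumr -big_split; apply: eq_bigr => i _.
    by rewrite dsum_linearE linearP.
  move=> i; apply: contraNT => nis.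
  have /eqP xi : x i == 0 by apply: contraNT nis => /xs.
  have /eqP yi : y i == 0 by apply: contraNT nis => /ys.
  by rewrite dsum_linearE xi yi scaler0 addr0.
exists (lin gL) => i u; rewrite [LHS]/=.
rewrite (total_indep (SP _).1 (isT : uniq [:: i : {classic I}]) (SP _).2).
  by rewrite /total big_seq1 dsum_inj_same.
move=> j; rewrite inE; apply: contraNT => ji.
by rewrite dsum_inj_other // => ij; move: ji; rewrite ij eqxx.
Qed.

End Lift.

(** The projection to the components in a list is built one index at a time.
   Sending x to (x_i, a(x - x_i)) rather than to (x_i, a x) makes the induction
   step work even if the index i already occurs in the rest of the list. *)
Lemma dsum_locally_split : (forall i, fin_gen (F i)) -> locally_split (dsum F).
Proof.
move=> fgF X.
suff H (s : seq {classic I}) : exists (E : lmodType R)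
    (a : {linear dsum F -> E}) (b : {linear E -> dsum F}), fin_gen E /\
    forall x : dsum F,
      (forall i : {classic I}, x i != 0 -> i \in s) -> b (a x) = x.
  have [S SP] := choice dsum_supp_seq.
  have [E [a [b [fgE abX]]]] := H (flatten (map S X)).
  exists E, a, b; split=> // x xX; apply: abX => i /(SP x).2 iS.
  by apply/flattenP; exists (S x); rewrite ?map_f.
elim: s => [|i s [E [a [b [fgE baX]]]]].
  exists 'rV[R]_0, \0, \0; split=> [|x x0].
    by exists 0%N, idfun => y; exists y.
  by apply: dsum_ext => i; apply/esym/eqP/negPn/negP => /x0.
have aL : linear (fun x : dsum F => (x i, a (x - dsum_inj (x i)))).
  move=> c x y; congr (_, _).
  rewrite [RHS]/= -linearP; congr (a _); apply: dsum_ext => j.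
  rewrite dsum_linearE !dsum_subE dsum_linearE dsum_inj_linear dsum_linearE.
  by rewrite scalerBr opprD addrACA.
have bL : linear (fun u : F i * E => dsum_inj u.1 + b u.2).
  by move=> c u v; rewrite (linearP b) dsum_inj_linear scalerDr addrACA.
exists (F i * E)%type, (lin aL), (lin bL); split; first exact: fin_gen_prod.
move=> x /dsum_sub_inj xs; rewrite /= baX => [|j /xs[]//].
by rewrite addrC subrK.
Qed.

End DirectSums.

(** * Pure-projective modules *)

Lemma finitely_presented_gen (R : comNzRingType) (M : lmodType R) :
  finitely_presented M -> fin_gen M.
Proof. by move=> [k [n [A [f [fS _]]]]]; exists n, f. Qed.

Lemma pure_projective_retract (R : comNzRingType) (P : lmodType R) :
  pure_projective P -> exists (I : Type) (F : I -> lmodType R)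
    (i : {linear P -> dsum F}) (r : {linear dsum F -> P}),
  (forall i, finitely_presented (F i)) /\ cancel i r.
Proof.
move=> [I [F [N [fpF [f [g gK fK]]]]]].
have gL : linear g.
  by move=> a x y; rewrite -[LHS]gK -{1}(fK x) -{1}(fK y) -linearP gK.
have iL : linear (fun x : P => f (x, 0)).
  move=> a x y; rewrite -linearP; congr (f _); congr (_, _).
  by rewrite /= scaler0 addr0.
have rL : linear (fun x => (g x).1) by move=> a x y; rewrite gL.
by exists I, F, (lin iL), (lin rL); split=> // x; rewrite /= gK.
Qed.

(** Padding by zero components makes two pure-projective modules retracts of the
   same direct sum, so that one index set serves for both. *)
Lemma pure_projective_common (R : comNzRingType) (P Q : lmodType R) :
    pure_projective P -> pure_projective Q ->
  exists (I : Type) (F : I -> lmodType R)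
    (iP : {linear P -> dsum F}) (rP : {linear dsum F -> P})
    (iQ : {linear Q -> dsum F}) (rQ : {linear dsum F -> Q}),
  [/\ forall i, finitely_presented (F i), cancel iP rP & cancel iQ rQ].
Proof.
move=> /pure_projective_retract [I [F [i [r [fpF iK]]]]].
move=> /pure_projective_retract [J [G [j [s [fpG jK]]]]].
pose H (l : I + J) : lmodType R :=
  match l with inl i => F i | inr j => G j end.
have [e eE] := dsum_lift (fun i => lin (@dsum_inj_linear _ _ H (inl i))).
have [p pE] := dsum_lift (fun l : I + J =>
  match l return {linear H l -> dsum F} with
  | inl i => lin (@dsum_inj_linear _ _ F i) | inr j => \0 end).
have [e' e'E] := dsum_lift (fun j => lin (@dsum_inj_linear _ _ H (inr j))).
have [p' p'E] := dsum_lift (fun l : I + J =>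
  match l return {linear H l -> dsum G} with
  | inl i => \0 | inr j => lin (@dsum_inj_linear _ _ G j) end).
have eK : cancel e p.
  apply: (dsum_map_ext (f := p \o e) (g := idfun)) => k u.
  by rewrite /= eE [LHS]pE.
have e'K : cancel e' p'.
  apply: (dsum_map_ext (f := p' \o e') (g := idfun)) => k u.
  by rewrite /= e'E [LHS]p'E.
exists (I + J)%type, H, (e \o i), (r \o p), (e' \o j), (s \o p').
split=> [[k|k]|x|x] //=; first by rewrite eK.
by rewrite e'K.
Qed.

(** * Quotient modules *)

Section QuotientModule.
Variables (R : comNzRingType) (V : lmodType R) (G : set V).

Definition qmod : Type := Quotient.quot (submod_span G).

HB.instance Definition _ := GRing.Zmodule.on qmod.

Definition qmod_pi (z : V) : qmod := \pi_(Quotient.quot (submod_span G))%qT z.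

Lemma qmod_pi_is_zmod : zmod_morphism qmod_pi.
Proof. by move=> x y; rewrite /qmod_pi raddfB. Qed.
HB.instance Definition _ :=
  GRing.isZmodMorphism.Build V qmod qmod_pi qmod_pi_is_zmod.

Lemma qmod_pi_eq z t : qmod_pi z = qmod_pi t <-> z - t \in submod_span G.
Proof. by rewrite Quotient.idealrBE; split => [/eqP|/eqP]. Qed.

Definition qmod_repr (z : qmod) : V := repr z.

Lemma qmod_reprK (z : qmod) : qmod_pi (qmod_repr z) = z.
Proof. exact: reprK. Qed.

Definition qmod_scale (a : R) (z : qmod) : qmod := qmod_pi (a *: qmod_repr z).

Lemma qmod_scaleE a z : qmod_scale a (qmod_pi z) = qmod_pi (a *: z).
Proof.
apply/qmod_pi_eq; rewrite -scalerBr; apply/rpredZ/qmod_pi_eq.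
exact: qmod_reprK.
Qed.

Lemma qmod_scaleA a b z : qmod_scale a (qmod_scale b z) = qmod_scale (a * b) z.
Proof. by rewrite -[z]qmod_reprK !qmod_scaleE scalerA. Qed.
Lemma qmod_scale1 : left_id 1 qmod_scale.
Proof. by move=> z; rewrite -[z]qmod_reprK !qmod_scaleE scale1r. Qed.
Lemma qmod_scaleDr : right_distributive qmod_scale +%R.
Proof.
move=> a z t; rewrite -[z]qmod_reprK -[t]qmod_reprK -raddfD.
by rewrite !qmod_scaleE scalerDr raddfD.
Qed.
Lemma qmod_scaleDl z : {morph qmod_scale^~ z : a b / a + b}.
Proof.
by move=> a b; rewrite -[z]qmod_reprK !qmod_scaleE scalerDl raddfD.
Qed.
HB.instance Definition _ := GRing.Zmodule_isLmodule.Build R qmod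
  qmod_scaleA qmod_scale1 qmod_scaleDr qmod_scaleDl.

Lemma qmod_pi_is_scalable : scalable qmod_pi.
Proof. by move=> a z; rewrite -qmod_scaleE. Qed.
HB.instance Definition _ :=
  GRing.isScalable.Build R _ _ _ qmod_pi qmod_pi_is_scalable.

End QuotientModule.

(** The image of e, realised as the quotient by its kernel. *)
Lemma split_idempotent (R : comNzRingType) (V : lmodType R)
    (e : {linear V -> V}) :
    (forall x, e (e x) = e x) ->
  exists (C : lmodType R) (i : {linear C -> V}) (r : {linear V -> C}),
    cancel i r /\ forall x, i (r x) = e x.
Proof.
move=> ee; pose G : set V := [set x | e x = 0]%classic.
have eq_pi x y : qmod_pi G x = qmod_pi G y -> e x = e y.
  move/qmod_pi_eq => xy; apply/eqP; rewrite -subr_eq0 -linearB; apply/eqP.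
  move: (x - y) xy; apply: (span_min (A := fun x => e x = 0)) => //.
    by rewrite linear0.
  by move=> a u v eu ev; rewrite linearP eu ev scaler0 addr0.
have iL : linear (fun z : qmod G => e (qmod_repr z)).
  move=> a z t; rewrite -linearP; apply: eq_pi.
  by rewrite qmod_reprK (linearP (qmod_pi G)) /= !qmod_reprK.
exists (qmod G), (lin iL), (qmod_pi G); split=> [z|x] /=.
  rewrite -[RHS]qmod_reprK; apply/qmod_pi_eq/mem_submod_span.
  by rewrite /G /= linearB ee subrr.
by apply: eq_pi; rewrite qmod_reprK.
Qed.

(** * Summands cut out by index sets *)

Section Supported.
Variables (R : comNzRingType) (I : Type) (F : I -> lmodType R).

Definition supported (K : set I) (x : dsum F) : Prop :=
  forall i, x i != 0 -> K i.

Lemma supported0 K : supported K 0.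
Proof. by move=> i; rewrite eqxx. Qed.

Lemma supported_lincomb K : lincomb_closed (supported K).
Proof.
move=> a x y xK yK i; rewrite dsum_linearE.
have [xi|/xK //] := eqVneq (x i) 0; have [yi|/yK //] := eqVneq (y i) 0.
by rewrite xi yi scaler0 addr0 eqxx.
Qed.

Lemma supportedB K x y : supported K x -> supported K y -> supported K (x - y).
Proof.
move=> xK yK; rewrite -scaleN1r addrC.
exact: supported_lincomb.
Qed.

Lemma supportedS (K L : set I) x : (K `<=` L)%classic ->
  supported K x -> supported L x.
Proof. by move=> KL xK i /xK /KL. Qed.

Lemma supported_inj (K : set I) i (u : F i) : K i -> supported K (dsum_inj u).
Proof.
move=> Ki j; have [<-//|ij] := pselect (i = j).
by rewrite dsum_inj_other // eqxx.
Qed.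

Lemma dsum_proj (K : set I) : exists p : {linear dsum F -> dsum F},
  (forall x, supported K (p x)) /\ (forall x, supported K x -> p x = x).
Proof.
have [p pE] := dsum_lift (fun i : I => if pselect (K i) is left _
  then lin (@dsum_inj_linear R I F i) else \0).
exists p; split=> x.
  apply: (dsum_ind (A := fun x => supported K (p x))) => [|a u v uK vK|i _].
  - by rewrite linear0; apply: supported0.
  - by rewrite linearP; apply: supported_lincomb.
  - by rewrite pE; case: pselect => [Ki|_];
       [exact: supported_inj|exact: supported0].
move=> xK; apply: (dsum_ind (A := fun x => p x = x)) => [|a u v pu pv|i /xK Ki].
- by rewrite linear0.
- by rewrite linearP pu pv.
- by rewrite pE; case: pselect.
Qed.

(** Stability is tested on the components only, which makes it compatible with
   unions of sets of indices; see [stable_supported]. *)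
Definition stable (T : dsum F -> dsum F) (K : set I) : Prop :=
  forall i (u : F i), K i -> supported K (T (dsum_inj u)).

Lemma stable_supported (T : {linear dsum F -> dsum F}) K x :
  stable T K -> supported K x -> supported K (T x).
Proof.
move=> TK xK; apply: (dsum_ind (A := fun x => supported K (T x))).
- by rewrite linear0; apply: supported0.
- by move=> a u v uK vK; rewrite linearP; apply: supported_lincomb.
- by move=> i /xK Ki; apply: TK.
Qed.

(** The indices that must be added to a set containing i to make it stable
   under T. *)
Definition nbr (T : dsum F -> dsum F) (i : I) : set I :=
  [set j | exists u : F i, T (dsum_inj u) j != 0]%classic.

Lemma countable_nbr (T : {linear dsum F -> dsum F}) i :
  fin_gen (F i) -> countable (nbr T i).
Proof.
move=> [n [f fS]].
pose S (k : 'I_n) : set I :=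
  [set j | T (dsum_inj (f (delta_mx 0 k))) j != 0]%classic.
have cS : countable (\bigcup_(k in [set: 'I_n]) S k)%classic.
  apply: bigcup_countable => [|k _]; first exact: countableP.
  exact/finite_set_countable/dsum_finsupp.
apply: sub_countable cS; apply: subset_card_le => j [u Tu].
have [v vu] := fS u; apply: contrapT => jS; move/eqP: Tu; apply.
have TL : linear (fun v => T (dsum_inj (f v)) j).
  by move=> a x y; rewrite !linearP dsum_inj_linear linearP.
rewrite -vu -[LHS]/(lin TL v) [v]row_sum_delta linear_sum big1 // => k _.
rewrite linearZ /=; suff -> : T (dsum_inj (f (delta_mx 0 k))) j = 0.
  by rewrite scaler0.
by apply/eqP/negPn/negP => Sjk; apply: jS; exists k.
Qed.

End Supported.

Lemma countable_closure (I : Type) (N : I -> set I) (i : I) :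
    (forall i, countable (N i)) ->
  exists C : set I,
    [/\ countable C, C i & forall j, C j -> (N j `<=` C)%classic].
Proof.
move=> cN; pose L := fix L n : set I :=
  if n is n'.+1 then (\bigcup_(j in L n') N j)%classic else [set i]%classic.
exists (\bigcup_(n in [set: nat]) L n)%classic; split.
- apply: bigcup_countable => [|n _]; first exact: countableP.
  elim: n => [|n IHn] /=; first exact: countable1.
  by apply: bigcup_countable.
- by exists 0%N.
- by move=> j [n _ Lj] k Njk; exists n.+1 => //; exists j.
Qed.

Lemma countably_generated_set (R : comNzRingType) (V : lmodType R) (A : set V) :
  countable A -> (forall y, y \in submod_span A) -> countably_generated V.
Proof.
move=> /countable_injP [f finj] AV.
have xP n : exists x, forall y, A y -> f y = n -> x = y.
  have [[y [Ay fy]]|noy] := pselect (exists y, A y /\ f y = n).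
    by exists y => z Az fz; apply: finj; rewrite ?inE ?fz.
  by exists 0 => y Ay fy; case: noy; exists y.
have [x xE] := choice xP; exists x => y; apply: span_mono (AV y) => z Az.
by exists (f z) => //; apply: xE.
Qed.

Section Complement.
Variables (R : comNzRingType) (I : Type) (F : I -> lmodType R) (P : lmodType R).
Variables (i : {linear P -> dsum F}) (r : {linear dsum F -> P}).
Hypotheses (iK : cancel i r) (fgF : forall k, fin_gen (F k)).
Variables (K L : set I).
Hypotheses (KL : (K `<=` L)%classic) (cKL : countable (L `\` K)%classic).
Hypotheses (Kst : stable (i \o r) K) (Lst : stable (i \o r) L).

(** For x in P, say that x lies in P_K if i x is supported in K.  As K is stable
   under ir, the map p_K = r o (projection to K) o i projects P onto P_K.  The
   projections p_K and p_L need not commute, but p_L p_K = p_K, whence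
   e = (1 - p_K) p_L is idempotent; it kills P_K and its image C is a complement
   of P_K in P_L.  The components with index in L \ K generate C, so C is
   countably generated. *)
Lemma stable_complement : exists (C : lmodType R)
    (j : {linear C -> P}) (s : {linear P -> C}),
  [/\ cancel j s, countably_generated C, forall c, supported L (i (j c)),
      forall x, supported K (i x) -> s x = 0
    & forall x, supported L (i x) -> supported K (i (x - j (s x)))].
Proof.
have [p [pK pE]] := dsum_proj F K; have [q [qL qE]] := dsum_proj F L.
pose pP : {linear P -> P} := r \o p \o i.
pose qP : {linear P -> P} := r \o q \o i.
have pPK x : supported K (i (pP x)) by apply: (stable_supported Kst).
have qPL x : supported L (i (qP x)) by apply: (stable_supported Lst).
have pPE x : supported K (i x) -> pP x = x by move=> ?; rewrite /= pE.
have qPE x : supported L (i x) -> qP x = x by move=> ?; rewrite /= qE.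
have eL : linear (fun x => qP x - pP (qP x)).
  move=> a x y; rewrite (linearP qP) (linearP pP) scalerBr opprD.
  exact: addrACA.
have eE x : supported L (i x) -> lin eL x = x - pP x.
  by move=> xL; rewrite -{2 3}(qPE x xL).
have eLL x : supported L (i (lin eL x)).
  by rewrite linearB; apply: supportedB => //; apply: supportedS KL _.
have [|C [j [s [jK js]]]] := split_idempotent (e := lin eL).
  move=> x; rewrite eE // -[RHS]subr0; congr (_ - _).
  rewrite [LHS](linearB pP (qP x) (pP (qP x))).
  by rewrite [X in _ - X]pPE ?subrr.
have e0 x : supported K (i x) -> lin eL x = 0.
  by move=> xK; rewrite eE ?pPE ?subrr //; apply: supportedS KL xK.
have s0 x : supported K (i x) -> s x = 0.
  by move=> xK; rewrite -[LHS]jK js e0 // linear0.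
have jL c : supported L (i (j c)) by rewrite -(jK c) js.
exists C, j, s; split=> //; last first.
  by move=> x xL; rewrite js eE // opprB addrC subrK.
pose n l := sval (cid (fgF l)); pose f l := sval (cid (svalP (cid (fgF l)))).
have fS l : forall y, exists x, f l x = y := svalP (cid (svalP (cid (fgF l)))).
pose gens l :=
  ((fun k => s (r (dsum_inj (f l (delta_mx 0 k))))) @` [set: 'I_(n l)])%classic.
apply: (countably_generated_set (A := (\bigcup_(l in L `\` K) gens l)%classic)).
  apply: bigcup_countable => // l _.
  exact/finite_set_countable/finite_image/finite_finset.
move=> c; rewrite -(jK c) -(iK (j c)).
apply: (dsum_ind (A := fun z => s (r z) \in submod_span _)).
- by rewrite !linear0 rpred0.
- by move=> a u v us vs; rewrite !linearP rpredD ?rpredZ.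
move=> l /jL Ll; have [Kl|nKl] := pselect (K l).
  by rewrite s0 ?rpred0 //; apply: Kst.
have [v <-] := fS l (i (j c) l).
have TL : linear (fun v => s (r (dsum_inj (f l v)))).
  by move=> a x y; rewrite linearP dsum_inj_linear !linearP.
rewrite -[X in X \in _]/(lin TL v) [v]row_sum_delta linear_sum.
apply: rpred_sum => k _; rewrite linearZ; apply: rpredZ.
by apply: mem_submod_span; exists l => //; exists k.
Qed.

End Complement.

(** * Lifting isomorphisms modulo the maximal ideal: the general case *)

(** The map induced by f from C to D forgets a part of f(c) in Q_K.  This part
   is sent by g into P_K, which is killed by the projection onto C, so that the
   induced maps compose to the map induced by gf. *)
Lemma complement_inverse_mod (R : comNzRingType) (m : idealr R)
    (P Q C D : lmodType R) (f : {linear P -> Q}) (g : {linear Q -> P})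
    (jC : {linear C -> P}) (sC : {linear P -> C})
    (jD : {linear D -> Q}) (sD : {linear Q -> D})
    (PK PL : P -> Prop) (QK QL : Q -> Prop) :
    (forall x, x - g (f x) \in imul m P) -> cancel jC sC ->
    (forall c, PL (jC c)) -> (forall x, PL x -> QL (f x)) ->
    (forall y, QL y -> QK (y - jD (sD y))) -> (forall y, QK y -> PK (g y)) ->
    (forall x, PK x -> sC x = 0) ->
  forall c, c - sC (g (jD (sD (f (jC c))))) \in imul m C.
Proof.
move=> gf jCK PLj fL QLs gK sC0 c; set y := f (jC c).
have -> : sC (g (jD (sD y))) = sC (g y).
  apply/esym/eqP; rewrite -subr_eq0 -!linearB; apply/eqP.
  exact/sC0/gK/QLs/fL.
by rewrite -{1}(jCK c) -linearB; apply/imul_map/gf.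
Qed.

Section Graphs.
Variables (R : comNzRingType) (I : Type) (F : I -> lmodType R).
Variables (P Q : lmodType R).
Variables (i : {linear P -> dsum F}) (r : {linear dsum F -> P}).
Hypothesis iK : cancel i r.

Lemma graph_total (G : P -> Q -> Prop) (K : set I) :
    G 0 0 ->
    (forall a x y x' y', G x y -> G x' y' -> G (a *: x + x') (a *: y + y')) ->
    (forall k (u : F k), K k -> exists y, G (r (dsum_inj u)) y) ->
  forall x, supported K (i x) -> exists y, G x y.
Proof.
move=> G0 GL Gr x xK; rewrite -(iK x).
apply: (dsum_ind (A := fun z => exists y, G (r z) y)).
- by exists 0; rewrite linear0.
- move=> a u v [y Gu] [y' Gv]; exists (a *: y + y').
  by rewrite linearP; apply: GL.
- by move=> k /xK Kk; apply: Gr.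
Qed.

End Graphs.

Section Lifting.
Variables (R : comNzRingType) (m : idealr R).
Hypotheses (noeR : noetherian R) (locR : local_with m).
Variables (I : Type) (F : I -> lmodType R) (P Q : lmodType R).
Variables (iP : {linear P -> dsum F}) (rP : {linear dsum F -> P}).
Variables (iQ : {linear Q -> dsum F}) (rQ : {linear dsum F -> Q}).
Hypotheses (fgF : forall k, fin_gen (F k)).
Hypotheses (iPK : cancel iP rP) (iQK : cancel iQ rQ).
Variables (f : {linear P -> Q}) (g : {linear Q -> P}).
Hypothesis fg : inverse_mod m f g.

(** The entry (a, b) goes from side a to side b, where P is the side false and Q
   is the side true. *)
Let T (b : bool * bool) : {linear dsum F -> dsum F} :=
  match b with
  | (false, false) => iP \o rP
  | (true, true) => iQ \o rQ
  | (false, true) => iQ \o f \o rP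
  | (true, false) => iP \o g \o rQ
  end.

Let N (l : I) : set I :=
  (\bigcup_(b in [set: bool * bool]) nbr (T b) l)%classic.

Let cN l : countable (N l).
Proof.
by apply: bigcup_countable => [|b _]; [exact: countableP|exact: countable_nbr].
Qed.

Let closed (K : set I) := forall l, K l -> (N l `<=` K)%classic.

Let closed_stable K b : closed K -> stable (T b) K.
Proof.
by move=> cK l u Kl k Tk; apply: (cK l Kl); exists b => //; exists u.
Qed.

Let f_supp K x : closed K -> supported K (iP x) -> supported K (iQ (f x)).
Proof.
move=> cK xK; rewrite -(iPK x).
exact: (stable_supported (closed_stable (b := (false, true)) cK) xK).
Qed.

Let g_supp K y : closed K -> supported K (iQ y) -> supported K (iP (g y)).
Proof.
move=> cK yK; rewrite -(iQK y).
exact: (stable_supported (closed_stable (b := (true, false)) cK) yK).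
Qed.

(** G is the graph of an isomorphism from P_K to Q_K, up to the pair (0, 0),
   which may be missing.  All the conditions are inherited by unions of chains,
   the empty one included; this is why totality is only required on the images
   of the components with index in K, from which it follows by [graph_total],
   and why (0, 0) is only restored by [add0]. *)
Record partial_iso (K : set I) (G : P -> Q -> Prop) : Prop := PartialIso {
  piso_closed : closed K;
  piso_lin : forall a x y x' y',
    G x y -> G x' y' -> G (a *: x + x') (a *: y + y');
  piso_supp : forall x y, G x y -> supported K (iP x) /\ supported K (iQ y);
  piso_dom : forall k (u : F k), K k -> exists y, G (rP (dsum_inj u)) y;
  piso_cod : forall k (u : F k), K k -> exists x, G x (rQ (dsum_inj u));
  piso_zero : forall x y, G x y -> (x = 0 <-> y = 0)
}.

Let add0 (G : P -> Q -> Prop) x y := G x y \/ x = 0 /\ y = 0.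

Let partial_iso_add0 K G : partial_iso K G -> partial_iso K (add0 G).
Proof.
case=> cK GL GS GD GC GZ; split=> //.
- move=> a x y x' y' [xy|[-> ->]] [xy'|[-> ->]]; rewrite ?scaler0 ?add0r.
  + by left; apply: GL.
  + have G00 := GL (-1) _ _ _ _ xy xy; rewrite !scaleN1r !addNr in G00.
    by left; apply: GL.
  + by left.
  + by right.
- by move=> x y [/GS //|[-> ->]]; rewrite !linear0; split; apply: supported0.
- by move=> k u /(GD k u) [y]; exists y; left.
- by move=> k u /(GC k u) [y]; exists y; left.
- by move=> x y [/GZ //|[-> ->]].
Qed.

(** L is obtained from K by adding a countable closed set containing l0.  The
   complements C and D of P_K and Q_K in P_L and Q_L are isomorphic by the
   countable case, and the sum of G and of the graph of t : C -> D is the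
   required extension. *)
Lemma partial_iso_extend K G l0 : partial_iso K G -> exists L H,
  [/\ partial_iso L H, (K `<=` L)%classic, L l0 & forall x y, G x y -> H x y].
Proof.
move=> /partial_iso_add0 [cK GL GS GD GC GZ].
have G0 : add0 G 0 0 by right.
have [C0 [countC0 C0l C0N]] := countable_closure l0 cN.
pose L := (K `|` C0)%classic.
have cL : closed L by move=> l [/cK H|/C0N H] k /H; [left|right].
have KL : (K `<=` L)%classic by move=> k; left.
have cLK : countable (L `\` K)%classic.
  by apply: sub_countable countC0; apply: subset_card_le => l [[]].
have KP := closed_stable (b := (false, false)) cK.
have KQ := closed_stable (b := (true, true)) cK.
have LP := closed_stable (b := (false, false)) cL.
have LQ := closed_stable (b := (true, true)) cL.
have [C [jC [sC [jCK gC CL C0' CK]]]] := stable_complement iPK fgF KL cLK KP LP.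
have [D [jD [sD [jDK gD DL D0' DK]]]] := stable_complement iQK fgF KL cLK KQ LQ.
have lsC : locally_split C.
  by apply: (locally_split_retract (i := iP \o jC) (r := sC \o rP)) => [c|];
     [rewrite /= iPK jCK | apply: dsum_locally_split].
have lsD : locally_split D.
  by apply: (locally_split_retract (i := iQ \o jD) (r := sD \o rQ)) => [c|];
     [rewrite /= iQK jDK | apply: dsum_locally_split].
have [t [t' tK t'K]] : lmod_iso C D.
  apply: (countable_lift (f0 := sD \o f \o jC) (g0 := sC \o g \o jD)
    noeR locR) => //; split.
  - apply: (complement_inverse_mod (PK := supported K \o iP)
      (PL := supported L \o iP) (QK := supported K \o iQ)
      (QL := supported L \o iQ)) => //=; first exact: fg.1.
    + by move=> x; apply: f_supp.
    + by move=> y; apply: g_supp.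
  - apply: (complement_inverse_mod (PK := supported K \o iQ)
      (PL := supported L \o iQ) (QK := supported K \o iP)
      (QL := supported L \o iP)) => //=; first exact: fg.2.
    + by move=> x; apply: g_supp.
    + by move=> y; apply: f_supp.
exists L, (fun x y => exists x0 y0 c,
  [/\ add0 G x0 y0, x = x0 + jC c & y = y0 + jD (t c)]).
have domG := graph_total iPK G0 GL GD.
have codG : forall y, supported K (iQ y) -> exists x, add0 G x y.
  apply: (graph_total iQK (G := fun y x => add0 G x y)) => //.
  by move=> a x y x' y'; apply: GL.
split=> //; last 2 first.
- by right.
- by move=> x y xy; exists x, y, 0; split; [left|..]; rewrite ?linear0 ?addr0.
split=> //.
- move=> a _ _ _ _ [x [y [c [xy -> ->]]]] [x' [y' [c' [xy' -> ->]]]].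
  exists (a *: x + x'), (a *: y + y'), (a *: c + c'); split; first exact: GL.
    by rewrite linearP scalerDr addrACA.
  by rewrite !linearP scalerDr addrACA.
- move=> _ _ [x [y [c [/GS [xK yK] -> ->]]]].
  rewrite !linearD -[iP x]scale1r -[iQ y]scale1r.
  by split; apply: supported_lincomb => //; apply: supportedS KL _.
- move=> k u Lk; set x := rP _.
  have [y xy] := domG _ (CK x (LP k u Lk)).
  exists (y + jD (t (sC x))), (x - jC (sC x)), y, (sC x).
  by rewrite subrK.
- move=> k u Lk; set y := rQ _.
  have [x xy] := codG _ (DK y (LQ k u Lk)).
  exists (x + jC (t' (sD y))), x, (y - jD (sD y)), (t' (sD y)).
  by rewrite t'K subrK.
- move=> _ _ [x [y [c [xy -> ->]]]]; have [xK yK] := GS _ _ xy; split=> xc.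
    have c0 : c = 0.
      by have := congr1 sC xc; rewrite linearD (C0' x xK) add0r jCK linear0.
    move: xc; rewrite c0 linear0 addr0 => /(GZ _ _ xy) ->.
    by rewrite !linear0 addr0.
  have c0 : c = 0.
    have := congr1 sD xc; rewrite linearD (D0' y yK) add0r jDK linear0 => tc0.
    by apply: (can_inj tK); rewrite tc0 linear0.
  move: xc; rewrite c0 !linear0 addr0 => /(GZ _ _ xy) ->.
  by rewrite addr0.
Qed.

(** The pairs (K, G) are encoded as subsets of the disjoint union of I and
   P * Q, so that the order on them is inclusion. *)
Lemma lift_iso : lmod_iso P Q.
Proof.
pose KK (A : set (I + P * Q)) : set I := [set l | A (inl l)]%classic.
pose GG (A : set (I + P * Q)) x y := A (inr (x, y)).
have [A|A [Apiso Amax]] :=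
    Zorn_bigcup (P := fun A => partial_iso (KK A) (GG A)).
  move=> Asub Atot; split.
  - move=> l [X AX Xl] k /(piso_closed (Asub X AX) Xl) Xk.
    by exists X.
  - move=> a x y x' y' [X AX Xxy] [Y AY Yxy].
    have [XY|YX] := Atot X Y AX AY.
      by exists Y => //; apply: (piso_lin (Asub Y AY)) => //; apply: XY.
    by exists X => //; apply: (piso_lin (Asub X AX)) => //; apply: YX.
  - move=> x y [X AX /(piso_supp (Asub X AX)) [xK yK]].
    by split; [apply: supportedS xK|apply: supportedS yK] => l Xl; exists X.
  - by move=> k u [X AX /(piso_dom (Asub X AX) u) [y xy]]; exists y, X.
  - by move=> k u [X AX /(piso_cod (Asub X AX) u) [y xy]]; exists y, X.
  - by move=> x y [X AX /(piso_zero (Asub X AX))].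
have KT l : KK A l.
  have [L [H [LH KL Ll GH]]] := partial_iso_extend l Apiso.
  pose B (z : I + P * Q) :=
    match z with inl k => L k | inr xy => H xy.1 xy.2 end.
  apply: contrapT => nAl; apply: (Amax B) => //.
  split=> [|AB]; last by apply/nAl/(AB (inl l)).
  by move=> [k /KL //|[x y] /GH].
have [_ GL _ GD GC GZ] := partial_iso_add0 Apiso.
have G0 : add0 (GG A) 0 0 by right.
have xT x : supported (KK A) x by move=> k _; apply: KT.
have domG x : exists y, add0 (GG A) x y.
  by apply: (graph_total iPK G0 GL GD (K := KK A)); apply: xT.
have codG y : exists x, add0 (GG A) x y.
  apply: (graph_total iQK (G := fun y x => add0 (GG A) x y) (K := KK A)) => //.
  by move=> a u v u' v'; apply: GL.
have GB x y x' y' : add0 (GG A) x y -> add0 (GG A) x' y' ->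
    add0 (GG A) (x' - x) (y' - y).
  move=> xy x'y'; rewrite addrC -scaleN1r [y' - _]addrC -[- y]scaleN1r.
  exact: GL.
have GE x y x' y' : add0 (GG A) x y -> add0 (GG A) x' y' -> x = x' <-> y = y'.
  move=> xy x'y'; have dP := GZ _ _ (GB _ _ _ _ x'y' xy).
  by split=> /eqP; rewrite -subr_eq0 => /eqP /dP /eqP;
     rewrite subr_eq0 => /eqP.
have [h hP] := choice domG; have [h' h'P] := choice codG.
have hL : linear h.
  by move=> a x y; apply: (GE _ _ _ _ (hP _) (GL a _ _ _ _ (hP x) (hP y))).1.
exists (lin hL), h' => [x|y] /=.
  exact: (GE _ _ _ _ (h'P _) (hP x)).2.
exact: (GE _ _ _ _ (hP _) (h'P y)).1.
Qed.

End Lifting.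

(** * Base change *)

Section BaseChangeMap.
Variables (R : comNzRingType) (S : comAlgType R).

(** The canonical map from Q to its base change. *)
Definition base_unit (Q : lmodType R) (y : Q) : base_change Q S :=
  pure_tensor y (1 : S).

Lemma base_change_pureE (Q : lmodType R) (y : Q) (s : S) :
  pure_tensor y s = s *: base_unit y :> base_change Q S.
Proof. by rewrite -[RHS]/(base_change_scale _ _) base_change_scaleE mulr1. Qed.

Lemma base_unitZ (Q : lmodType R) a (x : Q) :
  base_unit (a *: x) = a%:A *: base_unit x.
Proof. by rewrite -base_change_pureE [LHS]pure_tensorZl -pure_tensorZr. Qed.

Lemma base_unit_is_zmod (Q : lmodType R) : zmod_morphism (@base_unit Q).
Proof.
move=> x y; rewrite /base_unit [LHS]pure_tensorDl; congr (_ + _).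
by rewrite -[- y]scaleN1r -/(base_unit _) base_unitZ scaleN1r scaleN1r.
Qed.
HB.instance Definition _ (Q : lmodType R) := GRing.isZmodMorphism.Build
  Q (base_change Q S) (@base_unit Q) (@base_unit_is_zmod Q).

Lemma base_unitP (Q : lmodType R) a (x y : Q) :
  base_unit (a *: x + y) = a%:A *: base_unit x + base_unit y.
Proof. by rewrite raddfD /= base_unitZ. Qed.

Lemma base_change_ind (Q : lmodType R) (A : base_change Q S -> Prop) :
    A 0 -> (forall s y z, A z -> A (s *: base_unit y + z)) -> forall z, A z.
Proof.
move=> A0 AD; apply: tensor_ind => // y s z Az.
by have := AD s y z Az; rewrite -base_change_pureE.
Qed.

Lemma base_change_map (P Q : lmodType R) (f : {linear P -> Q}) :
  exists h : {linear base_change P S -> base_change Q S},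
    forall x, h (base_unit x) = base_unit (f x).
Proof.
pose b (x : P) (s : S) : tensor Q S := pure_tensor (f x) s.
have bB : bilinear_map b.
  split=> *; rewrite /b ?linearD ?linearZ /=.
  - exact: pure_tensorDl.
  - exact: pure_tensorDr.
  - exact: pure_tensorZl.
  - exact: pure_tensorZr.
pose h0 : base_change P S -> base_change Q S := tensor_lift b.
have hE x s : h0 (s *: base_unit x) = s *: base_unit (f x).
  by rewrite -!base_change_pureE; exact: (tensor_liftE bB).
have hD z z' : h0 (z + z') = h0 z + h0 z'.
  by have := tensor_lift_linear bB 1 z z'; rewrite !scale1r.
have h00 : h0 0 = 0.
  by apply: (addIr (h0 0)); rewrite -hD !add0r.
have hL : linear h0.
  move=> s z z'; rewrite hD; congr (_ + _).
  apply: (base_change_ind (A := fun z => h0 (s *: z) = s *: h0 z)).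
    by rewrite scaler0 h00 scaler0.
  by move=> t y u IH; rewrite scalerDr !hD IH scalerA !hE scalerDr scalerA.
exists (lin hL) => x.
by have := hE x 1; rewrite !scale1r.
Qed.

Lemma base_change_ext (P : lmodType R) (W : lmodType S)
    (f g : {linear base_change P S -> W}) :
  (forall x, f (base_unit x) = g (base_unit x)) -> f =1 g.
Proof.
move=> fg; apply: (base_change_ind (A := fun z => f z = g z)).
  by rewrite !linear0.
by move=> s y z IH; rewrite !linearP fg IH.
Qed.

Lemma base_change_iso (P Q : lmodType R) :
  lmod_iso P Q -> lmod_iso (base_change P S) (base_change Q S).
Proof.
move=> [f [g0 gK fK]].
have gL : linear g0.
  by move=> a x y; apply: (can_inj gK); rewrite linearP !fK.
pose g := lin gL.
have [F FE] := base_change_map f; have [G GE] := base_change_map g.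
exists F, G.
- apply: (base_change_ext (f := G \o F) (g := idfun)) => x /=.
  by rewrite FE GE /= gK.
- apply: (base_change_ext (f := F \o G) (g := idfun)) => x /=.
  by rewrite GE FE /= fK.
Qed.

End BaseChangeMap.

(** * Approximation over the completion *)

Section Completion.
Variables (R : comNzRingType) (m : idealr R).
Local Notation S := (completion m).
Local Notation "\eta" := (@base_unit R S _).

(** The kernel of the projection from the completion to R / m^(n+1). *)
Definition adic_ideal n : {pred S} := fun c => adic_coord c n == 0.

Lemma in_adic_ideal n c : (c \in adic_ideal n) = (adic_coord c n == 0).
Proof. by []. Qed.

Definition adic_close (Q : lmodType R) n (z : base_change Q S) (y : Q) : Prop :=
  z - \eta y \in imul (adic_ideal n) (base_change Q S).

Lemma adic_coordB (x y : S) n :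
  adic_coord (x - y) n = adic_coord x n - adic_coord y n.
Proof. by []. Qed.

Lemma algE (a : R) : a%:A = completion_of m a.
Proof. exact: mulr1. Qed.

Lemma adic_coord_alg (a : R) n : adic_coord (a%:A : S) n = adic_pi m n a.
Proof. by rewrite algE. Qed.

(** The finite set Y is the same for all n.  In [approximate_hom] it determines
   the finitely generated module to which the Artin-Rees lemma is applied, and
   that lemma in turn determines n. *)
Lemma adic_close_exists (Q : lmodType R) (z : base_change Q S) :
  exists Y : seq Q, forall n, exists y,
    y \in submod_span [set` Y] /\ adic_close n z y.
Proof.
elim/base_change_ind: z => [|s x z [Y YP]].
  exists [::] => n; exists 0; split; first exact: rpred0.
  by rewrite /adic_close raddf0 subr0 rpred0.
exists (x :: Y) => n; have [y [yY zy]] := YP n.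
exists (repr (adic_coord s n) *: x + y); split.
  apply: rpredD; first by apply/rpredZ/mem_submod_span; rewrite /= inE eqxx.
  by apply: span_mono yY => u /= uY; rewrite inE uY orbT.
rewrite /adic_close raddfD /= opprD addrACA; apply: rpredD => //.
rewrite base_unitZ -scalerBl; apply: mem_imul.
by rewrite in_adic_ideal adic_coordB adic_coord_alg adic_pi_surj subrr.
Qed.

Section ToQuotient.
Variables (Q : lmodType R) (n : nat).
Let W := qmod (@imul_gen R (ideal_pow m n.+1) Q).
Let pi : {linear Q -> W} := qmod_pi _.

Let pi_adic (a b : R) y :
  adic_pi m n a = adic_pi m n b -> pi (a *: y) = pi (b *: y).
Proof.
move=> /adic_pi_eq ab; apply/qmod_pi_eq; rewrite -scalerBl.
exact: (mem_imul (I := ideal_pow m n.+1)).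
Qed.

(** The map t from Q (x) S to Q / m^(n+1) Q that sends y (x) c to c_n y is well
   defined, extends the quotient map of Q and kills the multiples by
   [adic_ideal n]. *)
Let t (z : base_change Q S) : W :=
  tensor_lift (fun y (s : S) => pi (repr (adic_coord s n) *: y)) z.

Let t_bilinear :
  bilinear_map (fun y (s : S) => pi (repr (adic_coord s n) *: y)).
Proof.
split=> [x y s|x s s'|a x s|a x s].
- by rewrite scalerDr linearD.
- rewrite -linearD -scalerDl; apply: pi_adic.
  by rewrite rmorphD /= !adic_pi_surj.
- by rewrite scalerA mulrC -scalerA linearZ.
- transitivity (pi ((a * repr (adic_coord s n)) *: x)).
    by apply: pi_adic; rewrite rmorphM /= !adic_pi_surj.
  by rewrite -scalerA linearZ.
Qed.

Let tD z z' : t (z + z') = t z + t z'.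
Proof. by have := tensor_lift_linear t_bilinear 1 z z'; rewrite !scale1r. Qed.

Let t0 : t 0 = 0.
Proof. by apply: (addIr (t 0)); rewrite -tD !add0r. Qed.

Let tE s y : t (s *: \eta y) = pi (repr (adic_coord s n) *: y).
Proof. by rewrite -base_change_pureE; exact: (tensor_liftE t_bilinear). Qed.

Let t_ideal c z : c \in adic_ideal n -> t (c *: z) = 0.
Proof.
move=> /eqP c0; elim/base_change_ind: z => [|s y z IH].
  by rewrite scaler0 t0.
rewrite scalerDr tD IH addr0 scalerA tE -(linear0 pi) -(scale0r y).
by apply: pi_adic; rewrite adic_pi_surj rmorph0 /= c0 mul0r.
Qed.

Lemma adic_close0 (y : Q) : adic_close n 0 y -> y \in imul (ideal_pow m n.+1) Q.
Proof.
rewrite /adic_close sub0r => yn.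
have tn c : t (c *: (- \eta y)) = 0.
  move: (- _) yn c.
  apply: (span_min (A := fun z => forall c, t (c *: z) = 0))
    => [c|a z z' tz tz' c|].
  - by rewrite scaler0 t0.
  - by rewrite scalerDr tD tz' addr0 scalerA tz.
  - move=> _ [d [z [dn ->]]] c; rewrite scalerA; apply: t_ideal.
    by rewrite in_adic_ideal /= (eqP dn) mulr0.
have := tn (-1); rewrite scaleN1r opprK -[\eta y]scale1r tE => /=.
rewrite (pi_adic _ (b := 1)) ?adic_pi_surj ?rmorph1 // scale1r -(linear0 pi).
by move=> /qmod_pi_eq; rewrite subr0.
Qed.

End ToQuotient.

Lemma imul_adic_idealS (n k : nat) (W : lmodType S) z : (n <= k)%N ->
  z \in imul (adic_ideal k) W -> z \in imul (adic_ideal n) W.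
Proof.
move=> nk; apply: span_mono => _ [c [w [/eqP ck ->]]]; exists c, w; split=> //.
rewrite in_adic_ideal; elim: k nk ck => [|k IHk].
  by rewrite leqn0 => /eqP->/eqP.
rewrite leq_eqVlt => /predU1P[->/eqP //|nk ck]; apply: IHk => //.
by rewrite -adic_coordP ck rmorph0.
Qed.

Lemma base_unit_imul (Q : lmodType R) (y : Q) :
  y \in imul m Q -> \eta y \in imul (adic_ideal 0) (base_change Q S).
Proof.
move: y; apply: (span_min (A := fun y => \eta y \in imul (adic_ideal 0) _)).
- by rewrite raddf0 rpred0.
- by move=> a x y xm ym; rewrite raddfD /= base_unitZ rpredD ?rpredZ.
move=> _ [a [y [am ->]]]; rewrite base_unitZ; apply: mem_imul.
rewrite in_adic_ideal adic_coord_alg -(rmorph0 (adic_pi m 0)).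
apply/eqP/adic_pi_eq.
by rewrite subr0; apply: mem_submod_span; exists a, 1; rewrite mulr1.
Qed.

Section LiftHom.
Hypothesis noeR : noetherian R.
Variables (F Q : lmodType R).
Hypotheses (fpF : finitely_presented F) (lsQ : locally_split Q).
Variable theta : {additive F -> base_change Q S}.
Hypothesis thetaZ : forall a x, theta (a *: x) = a%:A *: theta x.

(** Let F be the cokernel of A, let z_j be the image under theta of the j-th
   generator of F, and let y_j in Q be close to z_j modulo m^(N+1).  As
   sum_j A_rj z_j = 0, the y_j satisfy the relations of F modulo m^(N+1) Q.
   Passing to a finitely generated module E through which the y_j factor, the
   Artin-Rees lemma for the map E^n -> E^k given by A provides zeta_j in mE such
   that the corrected elements a(y_j) - zeta_j satisfy the relations exactly;
   their images w_j in Q define h. *)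
Lemma approximate_hom :
  exists h : {linear F -> Q}, forall x, adic_close 0 (theta x) (h x).
Proof.
have [k [n [A [p [pS pA]]]]] := fpF.
pose z (j : 'I_n) := theta (p (delta_mx 0 j)).
have theta_p u : theta (p u) = \sum_j (u 0 j)%:A *: z j.
  rewrite {1}[u]row_sum_delta linear_sum raddf_sum; apply: eq_bigr => j _.
  by rewrite linearZ /= thetaZ.
have Az r : \sum_j (A r j)%:A *: z j = 0.
  have := theta_p (row r A); have -> : p (row r A) = 0.
    by apply/pA; exists (delta_mx 0 r); rewrite rowE.
  by rewrite raddf0; under eq_bigr do rewrite mxE.
have [Y YP] := choice (fun j => adic_close_exists (z j)).
have [E [a [b [fgE baY]]]] := lsQ (flatten [seq Y j | j <- enum 'I_n]).
have baS j y : y \in submod_span [set` Y j]%classic -> b (a y) = y.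
  apply: (eq_on_span (f := b \o a) (g := idfun)) => {}y yY /=.
  by apply: baY; apply/flattenP; exists (Y j); rewrite ?map_f ?mem_enum.
pose V : lmodType R := {ffun 'I_n -> E}.
pose W : lmodType R := {ffun 'I_k -> E}.
have TL : linear (fun q : V => [ffun r => \sum_j A r j *: q j] : W).
  move=> c q q'; apply/ffunP => r; rewrite !ffunE scaler_sumr -big_split.
  by apply: eq_bigr => j _; rewrite !ffunE scalerDr !scalerA mulrC.
have [N NP] := artin_rees m noeR (lin TL) (acc_ffun (fin_gen_acc noeR fgE)).
have [y yP] := choice (fun j => YP j N).
pose q : V := [ffun j => a (y j)].
have [|zeta zm zq] := NP q.
  apply: imul_ffun => r; rewrite ffunE.
  have -> : \sum_j A r j *: q j = a (\sum_j A r j *: y j).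
    by rewrite linear_sum; apply: eq_bigr => j _; rewrite ffunE linearZ.
  apply: imul_map.
  suff : \sum_j A r j *: y j \in imul (ideal_pow m N.+1) Q.
    apply: span_mono => _ [c [v [cN ->]]]; exists c, v; split=> //.
    exact: ideal_powSS.
  apply: adic_close0; rewrite /adic_close -(Az r) raddf_sum -sumrB.
  apply: rpred_sum => j _; rewrite /= base_unitZ -scalerBr; apply: rpredZ.
  exact: (yP j).2.
pose w j := b (q j - zeta j).
have wE j : w j = y j - b (zeta j).
  by rewrite /w linearB ffunE (baS j) //; apply: (yP j).1.
have Aw r : \sum_j A r j *: w j = 0.
  rewrite -[RHS](linear0 b); transitivity (b (\sum_j A r j *: (q j - zeta j))).
    by rewrite linear_sum; apply: eq_bigr => j _; rewrite linearZ.
  congr (b _); under eq_bigr do rewrite scalerBr.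
  rewrite sumrB; apply/eqP; rewrite subr_eq0; apply/eqP.
  by have := congr1 (fun x : W => x r) zq; rewrite /= !ffunE.
have h0L : linear (fun u : 'rV[R]_n => \sum_j u 0 j *: w j).
  move=> c u v; rewrite scaler_sumr -big_split; apply: eq_bigr => j _.
  by rewrite !mxE scalerDl scalerA.
pose h0 := lin h0L.
have h0A u : p u = 0 -> h0 u = 0.
  move=> /pA [v ->] /=.
  rewrite (eq_bigr (fun j => \sum_r v 0 r *: (A r j *: w j))).
    rewrite exchange_big big1 // => r _.
    by rewrite -scaler_sumr Aw scaler0.
  move=> j _; rewrite mxE scaler_suml; apply: eq_bigr => r _.
  by rewrite scalerA.
have h0E u v : p u = p v -> h0 u = h0 v.
  move=> uv; apply/eqP; rewrite -subr_eq0 -linearB; apply/eqP/h0A.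
  by rewrite linearB uv subrr.
have [s sP] := choice pS.
have hL : linear (fun x => h0 (s x)).
  by move=> c x x'; rewrite -linearP; apply: h0E; rewrite linearP !sP.
exists (lin hL) => x; rewrite /adic_close -{1}(sP x) theta_p.
rewrite [lin hL x]/= raddf_sum -sumrB; apply: rpred_sum => j _.
rewrite /= base_unitZ -scalerBr; apply: rpredZ.
rewrite wE raddfB /= opprB addrCA; apply: rpredD.
  apply: base_unit_imul; apply: imul_map.
  have eL : linear (fun f : V => f j) by move=> c f f'; rewrite !ffunE.
  exact: (imul_map (lin eL) zm).
exact: (imul_adic_idealS (leq0n N) (yP j).2).
Qed.

End LiftHom.

(** The approximations on the summands add up: being close is stable under
   linear combinations, so it can be checked on components. *)
Lemma approximate_base_map (P Q : lmodType R) (I : Type) (F : I -> lmodType R)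
    (i : {linear P -> dsum F}) (r : {linear dsum F -> P})
    (phi : {linear base_change P S -> base_change Q S}) :
    noetherian R -> cancel i r -> (forall k, finitely_presented (F k)) ->
    locally_split Q ->
  exists f : {linear P -> Q}, forall x, adic_close 0 (phi (\eta x)) (f x).
Proof.
move=> noeR iK fpF lsQ.
pose theta k : {additive F k -> base_change Q S} :=
  phi \o \eta \o r \o lin (@dsum_inj_linear R I F k).
have tZ k a u : theta k (a *: u) = a%:A *: theta k u.
  by rewrite /= dsum_injZ linearZ base_unitZ linearZ.
have [h hP] := dsum_lift (fun k =>
  sval (cid (approximate_hom noeR (fpF k) lsQ (tZ k)))).
exists (h \o i) => x; rewrite /= -{1}(iK x).
apply: (dsum_ind (A := fun z => adic_close 0 (phi (\eta (r z))) (h z))).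
- by rewrite /adic_close (linear0 r) (linear0 h) !raddf0 ?addr0 rpred0.
- move=> a u v au av; rewrite /adic_close !linearP !base_unitP linearP.
  by rewrite opprD addrACA -scalerBr rpredD ?rpredZ.
- move=> k _; rewrite hP.
  exact: (svalP (cid (approximate_hom _ _ _ (tZ k)))).
Qed.

(** In the base change of P, x - g(f x) is the sum of psi(phi x - f x) and of
   psi(f x) - g(f x), and linear maps over the completion preserve multiples by
   its ideals. *)
Lemma approximate_inverse (P Q : lmodType R)
    (phi : {linear base_change P S -> base_change Q S})
    (psi : {linear base_change Q S -> base_change P S})
    (f : {linear P -> Q}) (g : {linear Q -> P}) :
    cancel phi psi ->
    (forall x, adic_close 0 (phi (\eta x)) (f x)) ->
    (forall y, adic_close 0 (psi (\eta y)) (g y)) ->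
  forall x, x - g (f x) \in imul m P.
Proof.
move=> phiK phif psig x.
suff /adic_close0 : adic_close 0 0 (x - g (f x)).
  apply: span_mono => _ [a [v [am ->]]]; exists a, v; split=> //.
  exact: ideal_pow_sub1 am.
have etaB : \eta (x - g (f x)) =
    psi (phi (\eta x) - \eta (f x)) + (psi (\eta (f x)) - \eta (g (f x))).
  by rewrite linearB phiK subrKA raddfB.
rewrite /adic_close sub0r etaB rpredN; apply: rpredD; last exact: psig.
exact: (imul_map psi (phif x)).
Qed.

End Completion.

Theorem theorem9p11 (R : comNzRingType) (m : idealr R)
    (P Q : lmodType R) :
  noetherian R -> local_with m ->
  pure_projective P -> pure_projective Q ->
  (@lmod_iso R P Q <->
   @lmod_iso (completion m)
     (base_change P (completion m)) (base_change Q (completion m))).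
Proof.
move=> noeR locR ppP ppQ; split=> [|[phi [psi0 phiK psiK]]].
  exact: base_change_iso.
have psiL : linear psi0.
  by move=> a x y; apply: (can_inj phiK); rewrite linearP !psiK.
pose psi := lin psiL.
have [I [F [iP [rP [iQ [rQ [fpF iPK iQK]]]]]]] :=
  pure_projective_common ppP ppQ.
have fgF k : fin_gen (F k) by exact: finitely_presented_gen.
have lsF := dsum_locally_split fgF.
have lsP := locally_split_retract iPK lsF.
have lsQ := locally_split_retract iQK lsF.
have [f phif] := approximate_base_map phi noeR iPK fpF lsQ.
have [g psig] := approximate_base_map psi noeR iQK fpF lsP.
apply: (lift_iso noeR locR fgF iPK iQK (f := f) (g := g)); split.
  exact: (approximate_inverse (psi := psi) phiK phif psig).
exact: (approximate_inverse (phi := psi) psiK psig phif).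
Qed.
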